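(* For all $c\in\mathbb{T}$ and $t<0$, $$\sup_{\mu\in\mathcal{M}_c}\left(h(\mu)+\int t\psi_c\,\mathrm{d}\mu\right)=\sup_{\mu\in\mathcal{M}}\left(h(\mu)+\int t\psi_c\,\mathrm{d}\mu\right),$$ as an equality in $(-\infty,+\infty]$.
   Context: $\mathbb{T}=\mathbb{R}/\mathbb{Z}$ is the torus with the doubling map $T\colon x\mapsto 2x \pmod 1$. For $c\in\mathbb{T}$, $\psi_c\colon\mathbb{T}\to[-\infty,+\infty)$ is $\psi_c(x)=2\log(|\sin(\pi(x-c))|)$, with $\log 0=-\infty$. $\mathcal{M}$ is the set of $T$-invariant Borel probability measures on $\mathbb{T}$, and $\mathcal{M}_c\subset\mathcal{M}$ is the set of those $\mu\in\mathcal{M}$ whose support does not contain $c$. $h(\mu)$ is the measure-theoretic (Kolmogorov–Sinai) entropy of $\mu$ with respect to $T$ (natural logarithm). *)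

(* Defs.v *)
From HB Require Import structures.
From mathcomp Require Import all_boot all_order all_algebra.
From mathcomp Require Import ring_quotient.
From mathcomp Require Import all_classical all_reals all_analysis.

Set Implicit Arguments.
Unset Strict Implicit.
Unset Printing Implicit Defensive.

Import Order.TTheory GRing.Theory Num.Theory.
Import numFieldNormedType.Exports.

Local Open Scope classical_set_scope.
Local Open Scope ring_scope.

(* [Num.int] is the qualifier wrapping [Num.int_num_subdef]; only the latter
   carries the subgroup structure. *)
Definition integers (R : realType) : zmodClosed R :=
  GRing.ZmodClosed.clone R (@Num.int_num_subdef R) _.

Definition torus (R : realType) : Type :=
  ring_quotient.Quotient.quot (integers R).

Section torus_structures.
Variable R : realType.
Local Open Scope quotient_scope.
Local Notation T := (torus R).

HB.instance Definition _ := GRing.Zmodule.copy T (ring_quotient.Quotient.quot (integers R)).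
HB.instance Definition _ := Quotient.copy T (ring_quotient.Quotient.quot (integers R)).

Lemma torus_piB : {morph \pi_T : x y / x - y}.
Proof. exact: (raddfB (\pi_(ring_quotient.Quotient.quot (integers R)))). Qed.

Lemma torus_eqE (x y : R) : (\pi_T x == \pi_T y) = (x - y \is a Num.int).
Proof. by rewrite (ring_quotient.Quotient.idealrBE (integers R)). Qed.

HB.instance Definition _ := isPointed.Build T 0.

Definition torus_open (U : set T) := open (\pi_T @^-1` U : set R).

Let torus_openT : torus_open setT.
Proof. exact: openT. Qed.

Let torus_openI (U V : set T) :
  torus_open U -> torus_open V -> torus_open (U `&` V).
Proof. exact: openI. Qed.

Let torus_open_bigU (I : Type) (F : I -> set T) :
  (forall i, torus_open (F i)) -> torus_open (\bigcup_i F i).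
Proof. by move=> oF; apply: bigcup_open => i _; exact: oF. Qed.

HB.instance Definition _ := @isOpenTopological.Build T torus_open
  torus_openT torus_openI torus_open_bigU.

HB.instance Definition _ := Measurable.copy T
  (g_sigma_algebraType (@open T)).

End torus_structures.

Section torus_objects.
Variable R : realType.
Local Open Scope ereal_scope.

Definition doubling (x : torus R) : torus R := (x *+ 2)%R.

Lemma norm_sinDpiz (x : R) (m : int) :
  (`|sin (x + pi * m%:~R)| = `|sin x|)%R.
Proof.
have natE (n : nat) (y : R) : (`|sin (y + pi * n%:R)| = `|sin y|)%R.
  by rewrite mulr_natr (alternatingn (@sinDpi R)) normrM normrX normrN1 expr1n mul1r.
case: m => n; first exact: natE.
by rewrite NegzE mulrNz mulrN -(natE n.+1) subrK.
Qed.

(* [lne 0 = -oo], so [psi c c = -oo]. The choice of the representative of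
   [x - c] is irrelevant, see [psi_pi]. *)
Definition psi (c x : torus R) : \bar R :=
  2%:E * lne `|sin (pi * repr (x - c)%R)|%:E.

Lemma psi_pi (a b : R) :
  psi (\pi_(torus R)%qT a) (\pi_(torus R)%qT b)
  = 2%:E * lne `|sin (pi * (b - a))|%:E.
Proof.
rewrite /psi -torus_piB.
have : (repr (\pi_(torus R)%qT (b - a)) - (b - a))%R \is a Num.int.
  by rewrite -torus_eqE reprK.
move=> /intrP[m /eqP]; rewrite subr_eq => /eqP ->.
by rewrite addrC mulrDr norm_sinDpiz.
Qed.

Definition topological_support (mu : set (torus R) -> \bar R) : set (torus R) :=
  [set x | forall U, open_nbhs x U -> 0 < mu U].

Definition invariant_measures : set (probability (torus R) R) :=
  [set mu | forall A, measurable A -> mu (doubling @^-1` A) = mu A].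

Definition invariant_measures_avoiding (c : torus R) :
    set (probability (torus R) R) :=
  [set mu | invariant_measures mu /\ ~ topological_support mu c].

End torus_objects.

Section entropy.
Context d (X : measurableType d) (R : realType).
Variables (f : X -> X) (mu : probability X R).

(* Empty cells are allowed: they contribute [0 * ln 0 = 0] to the entropy. *)
Definition measurable_partition (k : nat) (A : 'I_k -> set X) : Prop :=
  [/\ forall i, measurable (A i), trivIset setT A & \bigcup_i A i = setT].

Definition partition_entropy (I : finType) (A : I -> set X) : R :=
  - \sum_i fine (mu (A i)) * ln (fine (mu (A i))).

(* The cells of the join of the partitions f^{-i} A for i < n. *)
Definition dynamical_join (k : nat) (A : 'I_k -> set X) (n : nat)
    (w : {ffun 'I_n -> 'I_k}) : set X :=
  \bigcap_(i : 'I_n) (iter i f @^-1` A (w i)).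

Definition entropy_wrt (k : nat) (A : 'I_k -> set X) : R :=
  lim ((n%:R^-1 * partition_entropy (@dynamical_join k A n)) @[n --> \oo]).

Definition ks_entropy : \bar R :=
  ereal_sup [set h | exists (k : nat) (A : 'I_k -> set X),
    measurable_partition A /\ h = (entropy_wrt A)%:E].

End entropy.

Definition free_energy (R : realType) (c : torus R) (t : R)
    (mu : probability (torus R) R) : \bar R :=
  (ks_entropy (@doubling R) mu + \int[mu]_x (t%:E * psi c x))%E.

(* Main.v *)
(** For t < 0 the potential phi = t psi_c is nonnegative and lower semicontinuous,
    hence the increasing limit of its infima phi_m over the dyadic intervals of
    rank m.  It therefore suffices to approximate an invariant measure mu, in
    entropy and in the law of each finite block of binary digits, by invariant
    measures whose support misses c.

    Let G_j overwrite, in the binary expansion of x, the digits at the positions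
    k with (k + j) mod N < l by the letters of a fixed marker s of length l.
    Since T G_j = G_(j+1) T, the measure nu = (1/N) sum_(j < N) (G_j)_* mu is
    invariant.  When 2^l > 3N + 1 the marker can be chosen so that no G_j x is
    close to c: such a point would read s inside one of at most 3N windows.  Only
    a proportion l/N of the digits is overwritten, so by concavity of entropy
    h(nu) >= h(mu) - (l/N) log 2, while the integral of phi_m with respect to nu
    is at least (1 - m l/N) times that with respect to mu.  With N = 2^a and
    l = a + 2 the ratio l/N tends to 0. *)
Require Import Defs.
From HB Require Import structures.
From mathcomp Require Import all_boot all_order all_algebra.
From mathcomp Require Import generic_quotient.
From mathcomp Require Import all_classical all_reals all_analysis.
From mathcomp Require Import measurable_realfun ring lra zify.

Set Implicit Arguments.
Unset Strict Implicit.
Unset Printing Implicit Defensive.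

Import Order.TTheory GRing.Theory Num.Theory.
Import numFieldNormedType.Exports.

Local Open Scope classical_set_scope.
Local Open Scope ring_scope.

(** * Entropy of finite distributions *)

Section finite_entropy.
Variable R : realType.
Implicit Types I J : finType.

(** The tangent at [y] to the convex function [x ln x] lies below its graph. The implication
    excludes [y = 0 < x], where the convention [ln 0 = 0] would break the bound. *)
Lemma mul_ln_tangent (x y : R) : 0 <= x -> 0 <= y -> (0 < x -> 0 < y) ->
  x * ln y + x - y <= x * ln x.
Proof.
rewrite le_eqVlt => /predU1P[<- y0 _|x0 _ /(_ x0) y0].
  by rewrite !mul0r !add0r oppr_le0.
have : ln (1 + (y / x - 1)) <= y / x - 1.
  by apply: le_ln1Dx; rewrite ltrBrDr addrC subrr divr_gt0.
rewrite addrC subrK ln_div ?posrE// => /(ler_wpM2l (ltW x0)).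
rewrite !mulrBr mulrCA divff ?gt_eqF// !mulr1; lra.
Qed.

Definition entropy I (p : I -> R) : R := - \sum_i p i * ln (p i).

(** The tangent inequality is summed over [i]; by the comparison of masses the linear terms
    [p i - q i] have a nonnegative sum. *)
Lemma gibbs I (p q : I -> R) : (forall i, 0 <= p i) -> (forall i, 0 <= q i) ->
  (forall i, 0 < p i -> 0 < q i) -> \sum_i q i <= \sum_i p i ->
  entropy p <= - \sum_i p i * ln (q i).
Proof.
move=> p0 q0 pq qp; rewrite /entropy lerN2.
have : \sum_i (p i * ln (q i) + p i - q i) <= \sum_i p i * ln (p i).
  by apply: ler_sum => i _; apply: mul_ln_tangent => //; exact: pq.
rewrite sumrB big_split /=; lra.
Qed.

Lemma entropy_ge0 I (p : I -> R) : (forall i, 0 <= p i <= 1) -> 0 <= entropy p.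
Proof.
move=> p01; rewrite oppr_ge0 sumr_le0// => i _.
by have /andP[p0 p1] := p01 i; rewrite mulr_ge0_le0// ln_le0.
Qed.

Lemma entropy_le_ln_card I (p : I -> R) : (forall i, 0 <= p i) ->
  \sum_i p i = 1 -> entropy p <= ln #|I|%:R.
Proof.
move=> p0 p1.
have I0 : (0 < #|I|)%N.
  rewrite lt0n; apply/eqP => I0; move: p1; rewrite big1 => [/eqP|i _].
    by rewrite eq_sym oner_eq0.
  by have := fintype0 i I0.
have cI0 : 0 < #|I|%:R :> R by rewrite ltr0n.
apply: le_trans (@gibbs _ _ (fun=> #|I|%:R^-1) p0 _ _ _) _ => [i|i _||].
- by rewrite invr_ge0 ler0n.
- by rewrite invr_gt0.
- by rewrite p1 sumr_const -[_ *+ _]mulr_natr mulVf// gt_eqF.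
- by rewrite -mulr_suml p1 mul1r lnV// opprK.
Qed.

(** Each [p i] is at most the mass of its fibre, and [ln] is increasing. *)
Lemma entropy_marginal_le I J (f : I -> J) (p : I -> R) :
  (forall i, 0 <= p i) -> entropy (fun j => \sum_(i | f i == j) p i) <= entropy p.
Proof.
move=> p0; rewrite /entropy lerN2 [leLHS](partition_big f predT)//=.
apply: ler_sum => j _; rewrite mulr_suml; apply: ler_sum => i /eqP fij.
have := p0 i; rewrite le_eqVlt => /predU1P[<-|pi0]; first by rewrite !mul0r.
have le_pi : p i <= \sum_(i' | f i' == j) p i'.
  by rewrite (bigD1 i) ?fij//= lerDl sumr_ge0.
by rewrite ler_pM2l// ler_ln// posrE (lt_le_trans pi0 le_pi).
Qed.

(** Subadditivity is Gibbs' inequality against the product of the two marginals. *)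
Lemma entropy_prod_le I J (p : I * J -> R) : (forall i, 0 <= p i) ->
  \sum_i p i = 1 ->
  entropy p <= entropy (fun i => \sum_(ij | ij.1 == i) p ij)
               + entropy (fun j => \sum_(ij | ij.2 == j) p ij).
Proof.
move=> p0 p1.
set p_1 := (fun i => _); set p_2 := (fun j => _).
have le1 ij : p ij <= p_1 ij.1.
  by rewrite /p_1 (bigD1 ij)//= lerDl sumr_ge0.
have le2 ij : p ij <= p_2 ij.2.
  by rewrite /p_2 (bigD1 ij)//= lerDl sumr_ge0.
have sum1 : \sum_i p_1 i = 1 by rewrite -p1 [RHS](partition_big fst predT).
have sum2 : \sum_i p_2 i = 1 by rewrite -p1 [RHS](partition_big snd predT).
apply: le_trans (@gibbs _ _ (fun ij => p_1 ij.1 * p_2 ij.2) p0 _ _ _) _.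
- by move=> ij; rewrite mulr_ge0// sumr_ge0.
- by move=> ij pij; rewrite mulr_gt0// (lt_le_trans pij).
- rewrite p1 -(pair_bigA _ (fun i j => p_1 i * p_2 j))/=.
  by under eq_bigr do rewrite -mulr_sumr sum2 mulr1; rewrite sum1.
rewrite -opprD lerN2 (_ : \sum_i p_1 i * ln (p_1 i) =
    \sum_ij p ij * ln (p_1 ij.1)); last first.
  rewrite [RHS](partition_big fst predT)//=; apply: eq_bigr => i _.
  by rewrite mulr_suml; apply: eq_bigr => ij /eqP->.
rewrite (_ : \sum_i p_2 i * ln (p_2 i) = \sum_ij p ij * ln (p_2 ij.2)); last first.
  rewrite [RHS](partition_big snd predT)//=; apply: eq_bigr => i _.
  by rewrite mulr_suml; apply: eq_bigr => ij /eqP->.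
rewrite -big_split/=; apply: ler_sum => ij _.
have := p0 ij; rewrite le_eqVlt => /predU1P[<-|pij]; first by rewrite !mul0r addr0.
by rewrite lnM ?posrE ?mulrDr// (lt_le_trans pij).
Qed.

(** The tangent inequality at the barycentre [q] is averaged with the weights [w j], which cancels
    the linear terms. *)
Lemma entropy_concave I J (w : J -> R) (p : J -> I -> R) :
  (forall j, 0 <= w j) -> (forall j i, 0 <= p j i) ->
  \sum_j w j = 1 ->
  \sum_j w j * entropy (p j) <= entropy (fun i => \sum_j w j * p j i).
Proof.
move=> w0 p0 w1; rewrite /entropy.
under eq_bigr do rewrite mulrN mulr_sumr.
rewrite sumrN lerN2 exchange_big/=; apply: ler_sum => i _.
set q := \sum_j w j * p j i.
have q0 : 0 <= q by apply: sumr_ge0 => j _; exact: mulr_ge0.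
have : \sum_j w j * (p j i * ln q + p j i - q) <= \sum_j w j * (p j i * ln (p j i)).
  apply: ler_sum => j _; have := w0 j.
  rewrite le_eqVlt => /predU1P[<-|wj0]; first by rewrite !mul0r.
  rewrite ler_pM2l//; apply: mul_ln_tangent => // pji0.
  apply: (@lt_le_trans _ _ (w j * p j i)); first by rewrite mulr_gt0.
  by rewrite /q (bigD1 j)//= lerDl sumr_ge0// => j' _; exact: mulr_ge0.
apply: le_trans.
under [X in _ <= X]eq_bigr do rewrite mulrBr mulrDr mulrA.
by rewrite sumrB big_split/= -!mulr_suml w1 -/q; lra.
Qed.

End finite_entropy.

(** * Finite-valued random variables *)

Section finite_random_variables.
Context d (X : measurableType d) (R : realType).
Implicit Types (mu : probability X R) (I J K : finType).

(** A finite partition is encoded as a map to a finite type, its cells being the fibres. Coarsening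
    is then composition, and joins are pairs or blocks. *)
Definition finite_rv I (Y : X -> I) := forall i, measurable (Y @^-1` [set i]).

Definition pmf mu I (Y : X -> I) (i : I) : R := fine (mu (Y @^-1` [set i])).

Lemma finite_rv_preimage I (Y : X -> I) : finite_rv Y ->
  forall A : set I, measurable (Y @^-1` A).
Proof.
move=> mY A; rewrite (_ : Y @^-1` A = \bigcup_(i in A) (Y @^-1` [set i])).
  by apply: fin_bigcup_measurable => // i _; exact: mY.
by apply/seteqP; split=> [x Ax|x [i Ai /= ->//]]; exists (Y x).
Qed.

Lemma finite_rv_comp I J (f : I -> J) (Y : X -> I) :
  finite_rv Y -> finite_rv (f \o Y).
Proof. by move=> mY j; rewrite comp_preimage; exact: finite_rv_preimage. Qed.

Lemma finite_rv_pair I J (Y : X -> I) (Z : X -> J) :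
  finite_rv Y -> finite_rv Z -> finite_rv (fun x => (Y x, Z x)).
Proof.
move=> mY mZ [i j].
rewrite (_ : _ @^-1` _ = Y @^-1` [set i] `&` Z @^-1` [set j]).
  by apply: measurableI; [exact: mY|exact: mZ].
by apply/seteqP; split=> x /= [-> ->].
Qed.

Definition block I n (Y : nat -> X -> I) (x : X) : {ffun 'I_n -> I} :=
  [ffun i : 'I_n => Y i x].
Arguments block {I} n Y x.

Lemma block_preimage I n (Y : nat -> X -> I) (w : {ffun 'I_n -> I}) :
  block n Y @^-1` [set w] = \bigcap_(i : 'I_n) (Y i @^-1` [set w i]).
Proof.
apply/seteqP; split=> [x /= <- i _ /=|x Yx /=]; first by rewrite ffunE.
by apply/ffunP => i; rewrite ffunE; exact: (Yx i).
Qed.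

Lemma finite_rv_block I n (Y : nat -> X -> I) :
  (forall i, finite_rv (Y i)) -> finite_rv (block n Y).
Proof.
move=> mY w; rewrite block_preimage.
by apply: fin_bigcap_measurable => // i _; exact: mY.
Qed.

Lemma pmf_preimage mu I (Y : X -> I) (P : {pred I}) : finite_rv Y ->
  fine (mu (Y @^-1` [set` P])) = \sum_(i | P i) pmf mu Y i.
Proof.
move=> mY; rewrite (_ : Y @^-1` [set` P] = \bigcup_(i in [set` P]) (Y @^-1` [set i])).
  rewrite measure_fin_bigcup//; first last.
  - by move=> i j _ _ [x [/= <- <-]].
  rewrite -(@bigfs _ _ _ _ (index_enum I)) ?index_enum_uniq//; last first.
    by move=> i; rewrite mem_index_enum.
  by rewrite sum_fine// => i _; rewrite fin_num_measure.
by apply/seteqP; split=> [x Ax|x [i Ai /= ->//]]; exists (Y x).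
Qed.

Lemma pmf_ge0 mu I (Y : X -> I) i : 0 <= pmf mu Y i.
Proof. by rewrite fine_ge0. Qed.

Lemma pmf_sum1 mu I (Y : X -> I) : finite_rv Y -> \sum_i pmf mu Y i = 1.
Proof.
move=> mY; rewrite -(@pmf_preimage mu I Y xpredT)// (_ : _ @^-1` _ = setT).
  by rewrite probability_setT.
by apply/seteqP.
Qed.

Lemma pmf_le1 mu I (Y : X -> I) i : finite_rv Y -> pmf mu Y i <= 1.
Proof.
move=> mY; rewrite -(pmf_sum1 mu mY) (bigD1 i)//= lerDl sumr_ge0// => j _.
exact: pmf_ge0.
Qed.

Lemma pmf_comp mu I J (f : I -> J) (Y : X -> I) j : finite_rv Y ->
  pmf mu (f \o Y) j = \sum_(i | f i == j) pmf mu Y i.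
Proof.
move=> mY; rewrite -(@pmf_preimage mu I Y (fun i => f i == j))//.
congr (fine (mu _)); apply/seteqP.
by split=> x /= /eqP.
Qed.

Definition rv_entropy mu I (Y : X -> I) : R := entropy (pmf mu Y).

Lemma rv_entropy_comp_le mu I J (f : I -> J) (Y : X -> I) : finite_rv Y ->
  rv_entropy mu (f \o Y) <= rv_entropy mu Y.
Proof.
move=> mY; rewrite /rv_entropy (_ : pmf mu (f \o Y) = fun j => \sum_(i | f i == j) pmf mu Y i).
  by apply: entropy_marginal_le => i; exact: pmf_ge0.
by apply/funext => j; exact: pmf_comp.
Qed.

Lemma rv_entropy_pair_le mu I J (Y : X -> I) (Z : X -> J) :
  finite_rv Y -> finite_rv Z ->
  rv_entropy mu (fun x => (Y x, Z x)) <= rv_entropy mu Y + rv_entropy mu Z.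
Proof.
move=> mY mZ; have mYZ := finite_rv_pair mY mZ.
apply: le_trans (entropy_prod_le _ (pmf_sum1 mu mYZ)) _.
  by move=> ij; exact: pmf_ge0.
rewrite /rv_entropy (_ : (fun i => _) = pmf mu Y); last first.
  by apply/funext => i; rewrite -(pmf_comp mu fst _ mYZ).
by rewrite (_ : (fun i => _) = pmf mu Z)//;
  apply/funext => i; rewrite -(pmf_comp mu snd _ mYZ).
Qed.

Lemma rv_entropy_ge0 mu I (Y : X -> I) : finite_rv Y -> 0 <= rv_entropy mu Y.
Proof. by move=> mY; apply: entropy_ge0 => i; rewrite pmf_ge0 pmf_le1. Qed.

Lemma rv_entropy_le_ln_card mu I (Y : X -> I) : finite_rv Y ->
  rv_entropy mu Y <= ln #|I|%:R.
Proof.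
move=> mY; apply: entropy_le_ln_card; last exact: pmf_sum1.
by move=> i; exact: pmf_ge0.
Qed.

(** The long block is a function of the pair of short ones, so the bounds for compositions and pairs
    apply. *)
Lemma rv_entropy_block_add mu I m n (Y : nat -> X -> I) :
  (forall i, finite_rv (Y i)) ->
  rv_entropy mu (block (m + n) Y) <=
  rv_entropy mu (block m Y) + rv_entropy mu (block n (fun i => Y (m + i)%N)).
Proof.
move=> mY; have mY1 := @finite_rv_block _ m _ mY.
have mY2 : finite_rv (block n (fun i => Y (m + i)%N)) by exact: finite_rv_block.
pose glue (w : {ffun 'I_m -> I} * {ffun 'I_n -> I}) : {ffun 'I_(m + n) -> I} :=
  [ffun i : 'I_(m + n) => match fintype.split i with inl a => fun_of_fin w.1 a
    | inr b => fun_of_fin w.2 b end].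
rewrite (_ : block (m + n) Y =
    glue \o (fun x => (block m Y x, block n (fun i => Y (m + i)%N) x))).
  apply: le_trans (rv_entropy_pair_le mu mY1 mY2).
  by apply: rv_entropy_comp_le; exact: finite_rv_pair.
apply/funext => x; apply/ffunP => i; rewrite !ffunE /=.
by case: fintype.splitP => j ij; rewrite ffunE ij.
Qed.

Lemma rv_entropy_block1 mu I (Y : nat -> X -> I) : finite_rv (Y 0%N) ->
  rv_entropy mu (block 1 Y) <= rv_entropy mu (Y 0%N).
Proof.
move=> mY; rewrite (_ : block 1 Y = (fun a => [ffun=> a] : {ffun 'I_1 -> I}) \o Y 0%N).
  exact: rv_entropy_comp_le.
by apply/funext => x; apply/ffunP => i; rewrite !ffunE /= ord1.
Qed.

Lemma rv_entropy_block_le_sum mu I n (Y : nat -> X -> I) :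
  (forall i, finite_rv (Y i)) ->
  rv_entropy mu (block n Y) <= \sum_(i < n) rv_entropy mu (Y i).
Proof.
move=> mY; elim: n => [|n IHn].
  apply: le_trans (rv_entropy_le_ln_card mu (@finite_rv_block _ 0 _ mY)) _.
  by rewrite card_ffun card_ord expn0 ln1 big_ord0.
rewrite big_ord_recr/= -addn1.
apply: le_trans (rv_entropy_block_add mu n 1 mY) _; apply: lerD => //.
apply: le_trans (rv_entropy_block1 _ _) _; last by rewrite addn0.
exact: mY.
Qed.

(* The correction variables [E i], from which [g i] recovers the process out of
   [Y i], play the role of conditional entropy. *)
Lemma rv_entropy_block_correction mu I J K n (g : nat -> J * K -> I)
    (Y : nat -> X -> J) (E : nat -> X -> K) :
  (forall i, finite_rv (Y i)) -> (forall i, finite_rv (E i)) ->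
  rv_entropy mu (block n (fun i x => g i (Y i x, E i x))) <=
  rv_entropy mu (block n Y) + \sum_(i < n) rv_entropy mu (E i).
Proof.
move=> mY mE.
have mbY := @finite_rv_block _ n _ mY; have mbE := @finite_rv_block _ n _ mE.
pose h (w : {ffun 'I_n -> J} * {ffun 'I_n -> K}) : {ffun 'I_n -> I} :=
  [ffun i : 'I_n => g i (w.1 i, w.2 i)].
rewrite (_ : block n _ = h \o (fun x => (block n Y x, block n E x))); last first.
  by apply/funext => x; apply/ffunP => i; rewrite !ffunE.
apply: le_trans (rv_entropy_comp_le mu h (finite_rv_pair mbY mbE)) _.
apply: le_trans (rv_entropy_pair_le mu mbY mbE) _.
by rewrite lerD2l; exact: rv_entropy_block_le_sum.
Qed.

(** For [x > 0] this is [ln y < y] at [y = 1 / sqrt x], multiplied by [2 x]. *)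
Lemma ln_le_2sqrt (x : R) : 0 <= x -> - (x * ln x) <= 2 * Num.sqrt x.
Proof.
rewrite le_eqVlt => /predU1P[<-|x0]; first by rewrite mul0r oppr0 sqrtr0 mulr0.
set s := Num.sqrt x; have s0 : 0 < s by rewrite sqrtr_gt0.
have xs : x = s ^+ 2 by rewrite sqr_sqrtr// ltW.
have : ln s^-1 < s^-1 by rewrite ln_sublinear// invr_gt0.
rewrite lnV ?posrE// xs lnXn// => /ltW/(ler_wpM2l (ltW s0)).
rewrite divff ?gt_eqF// => h.
rewrite mulr2n mulrDr -mulrDr.
have := ler_wpM2l (ltW s0) h; lra.
Qed.

Lemma opp_mul_ln_le (x : R) : 0 <= x -> - (x * ln x) <= 1 - x.
Proof.
move=> x0; have := @mul_ln_tangent R x 1 x0 ler01 (fun=> ltr01).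
by rewrite ln1 mulr0; lra.
Qed.

(** Meant for a variable recording the errors of an approximation. The value [None], no error,
    contributes at most one minus its mass; every other value has mass at most [s ^+ 2] and
    contributes at most [2 * s]. *)
Lemma rv_entropy_option_small mu I (s : R) (E : X -> option I) : finite_rv E ->
  0 <= s -> 1 - pmf mu E None <= s ^+ 2 ->
  rv_entropy mu E <= s ^+ 2 + #|I|%:R * (2 * s).
Proof.
move=> mE s0 hs; rewrite /rv_entropy /entropy.
rewrite -sumrN (bigD1 None)//=; apply: lerD.
  by apply: le_trans hs; exact/opp_mul_ln_le/pmf_ge0.
apply: (@le_trans _ _ (\sum_(i : option I | i != None) (2 * s))); last first.
  by rewrite sumr_const cardC1 card_option -[leLHS]mulr_natl.
apply: ler_sum => i iN; apply: le_trans (ln_le_2sqrt _) _; first exact: pmf_ge0.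
rewrite ler_pM2l// -(ger0_norm s0) -sqrtr_sqr ler_wsqrtr//.
apply: le_trans hs; rewrite -(pmf_sum1 mu mE) (bigD1 None)//= (bigD1 i)//=.
rewrite addrAC subrr add0r lerDl sumr_ge0// => j _; exact: pmf_ge0.
Qed.

End finite_random_variables.
Arguments block {d X I} n Y x.

(** * Entropy rate of stationary processes *)

(** The limit is the infimum of [u n / n] over positive [n]. If some ratio is close to the infimum,
    Euclidean division by its index bounds [u n / n] by that ratio plus a term of order [1 / n]. *)
Lemma fekete (R : realType) (u : nat -> R) : (forall n, 0 <= u n) ->
  (forall m n, u (m + n)%N <= u m + u n) -> cvgn (fun n => n%:R^-1 * u n).
Proof.
move=> u0 subu.
have u_mul q a : u (a * q)%N <= a%:R * u q + u 0%N.
  elim: a => [|a IHa]; first by rewrite mul0n mul0r add0r.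
  by rewrite mulSn (le_trans (subu _ _))// -natr1 mulrDl mul1r; lra.
have u_lin n : u n <= n%:R * u 1%N + u 0%N by rewrite -{1}(muln1 n).
pose A := [set n.+1%:R^-1 * u n.+1 | n in [set: nat]].
have A0 : lbound A 0 by move=> _ [n _ <-]; rewrite mulr_ge0.
have infA : has_inf A by split; [exists (1%:R^-1 * u 1%N), 0%N|exists 0].
suff cvgA (e : R) : 0 < e -> exists n0, forall n, (n0 < n)%N ->
    `|inf A - n%:R^-1 * u n| <= e.
  apply/cvg_ex; exists (inf A) => /=; apply/cvgrPdist_le => e /cvgA[n0 n0P].
  by exists n0.+1.
move=> e0.
have e20 : 0 < e / 2 by lra.
have [_ [q _ <-] qA] := inf_adherent e20 infA.
(* Independent of [n]: the first [u 0] comes from [u_mul], and the rest bounds [u] at any remainder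
   modulo [q.+1]. *)
set M := u 0%N + (q.+1%:R * u 1%N + u 0%N).
have M0 : 0 <= M by rewrite !addr_ge0 ?mulr_ge0.
have [n0 n0P] : exists n0 : nat, M / (e / 2) < n0.+1%:R.
  exists (Num.truncn (M / (e / 2))).
  by rewrite truncnS_gt ?realE ?divr_ge0// ltW.
exists n0 => n n0n.
have n1 : (0 < n)%N by exact: leq_ltn_trans n0n.
have n_gt0 : 0 < n%:R :> R by rewrite ltr0n.
have infn : inf A <= n%:R^-1 * u n.
  apply: ge_inf; first by exists 0.
  by exists n.-1 => //; rewrite prednK.
rewrite distrC ger0_norm ?subr_ge0// lerBlDl.
have un : u n <= n%:R * (q.+1%:R^-1 * u q.+1) + M.
  rewrite {1}(divn_eq n q.+1); apply: le_trans (subu _ _) _.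
  rewrite /M addrA; apply: lerD.
    apply: le_trans (u_mul _ _) _; rewrite lerD2r mulrA ler_wpM2r//.
    by rewrite ler_pdivlMr ?ltr0n// -natrM ler_nat leq_trunc_div.
  apply: le_trans (u_lin _) _; rewrite lerD2r ler_wpM2r// ler_nat.
  by rewrite ltnW// ltn_pmod.
apply: (@le_trans _ _ (q.+1%:R^-1 * u q.+1 + n%:R^-1 * M)).
  rewrite -(@ler_pM2l _ n%:R)// mulrDr !mulrA divff ?gt_eqF// !mul1r.
  by rewrite -[n%:R / _ * _]mulrA.
have : n%:R^-1 * M <= e / 2.
  rewrite mulrC ler_pdivrMr// mulrC -ler_pdivrMr//.
  by apply: ltW; apply: lt_le_trans n0P _; rewrite ler_nat.
by move=> h; rewrite [e in leRHS]splitr addrA lerD// ltW.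
Qed.

Section entropy_rate.
Context d (X : measurableType d) (R : realType).
Variable f : X -> X.
Hypothesis mf : forall A, measurable A -> measurable (f @^-1` A).
Implicit Types (mu nu : probability X R) (I J : finType).

Definition orbit_rv I (Y : X -> I) (i : nat) (x : X) : I := Y (iter i f x).

Definition entropy_rate mu I (Y : X -> I) : R :=
  limn (fun n => n%:R^-1 * rv_entropy mu (block n (orbit_rv Y))).

Lemma measurable_iter i A : measurable A -> measurable (iter i f @^-1` A).
Proof. by elim: i A => [//|i IHi] A mA; apply: (IHi (f @^-1` A)); exact: mf. Qed.

Lemma finite_rv_orbit I (Y : X -> I) i : finite_rv Y -> finite_rv (orbit_rv Y i).
Proof. by move=> mY j; apply: (@measurable_iter i (Y @^-1` [set j])); exact: mY. Qed.

Lemma pmf_iter mu I (Y : X -> I) i :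
  (forall A, measurable A -> mu (f @^-1` A) = mu A) -> finite_rv Y ->
  pmf mu (orbit_rv Y i) = pmf mu Y.
Proof.
move=> muf mY; apply/funext => j; rewrite /pmf; congr (fine _).
have mYj := mY j; elim: i => [//|i IHi]; rewrite -[RHS]IHi//.
rewrite -[in RHS](muf (iter i f @^-1` (Y @^-1` [set j]))); last exact: measurable_iter.
by congr (mu _); apply/seteqP; split=> x /=; rewrite -iterSr.
Qed.

(** The tail of the block is the block of length [n] read after [m] steps, which has the same law by
    invariance. *)
Lemma rv_entropy_orbit_add mu I (Y : X -> I) m n :
  (forall A, measurable A -> mu (f @^-1` A) = mu A) -> finite_rv Y ->
  rv_entropy mu (block (m + n) (orbit_rv Y)) <=
  rv_entropy mu (block m (orbit_rv Y)) + rv_entropy mu (block n (orbit_rv Y)).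
Proof.
move=> muf mY.
have mO i : finite_rv (orbit_rv Y i) by exact: finite_rv_orbit.
apply: le_trans (rv_entropy_block_add mu m n mO) _; rewrite lerD2l.
rewrite /rv_entropy -(pmf_iter m muf (@finite_rv_block _ _ _ n _ mO)).
rewrite (_ : block n _ = orbit_rv (block n (orbit_rv Y)) m)//.
apply/funext => x; apply/ffunP => i; rewrite !ffunE /orbit_rv.
by rewrite addnC iterD.
Qed.

Lemma entropy_rate_cvg mu I (Y : X -> I) :
  (forall A, measurable A -> mu (f @^-1` A) = mu A) -> finite_rv Y ->
  cvgn (fun n => n%:R^-1 * rv_entropy mu (block n (orbit_rv Y))).
Proof.
move=> muf mY; apply: fekete => [n|m n]; last exact: rv_entropy_orbit_add.
by apply: rv_entropy_ge0; apply: finite_rv_block => i; exact: finite_rv_orbit.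
Qed.

Lemma entropy_rate_ge0 mu I (Y : X -> I) :
  (forall A, measurable A -> mu (f @^-1` A) = mu A) -> finite_rv Y ->
  0 <= entropy_rate mu Y.
Proof.
move=> muf mY; apply: limr_ge; first exact: entropy_rate_cvg.
near=> n; rewrite mulr_ge0//; apply: rv_entropy_ge0.
by apply: finite_rv_block => i; exact: finite_rv_orbit.
Unshelve. all: by end_near. Qed.

(** After division by [n] the constant error [C] disappears in the limit and the linear error leaves
    [e]. *)
Lemma entropy_rate_le mu nu I J (Y : X -> I) (Z : X -> J) (C e : R) :
  (forall A, measurable A -> mu (f @^-1` A) = mu A) ->
  (forall A, measurable A -> nu (f @^-1` A) = nu A) ->
  finite_rv Y -> finite_rv Z ->
  (forall n, rv_entropy mu (block n (orbit_rv Y)) <=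
    rv_entropy nu (block n (orbit_rv Z)) + C + n%:R * e) ->
  entropy_rate mu Y <= entropy_rate nu Z + e.
Proof.
move=> muf nuf mY mZ le_YZ.
have cvY := entropy_rate_cvg muf mY; have cvZ := entropy_rate_cvg nuf mZ.
have cvC : (fun n => C * n.+1%:R^-1 : R) @ \oo --> (0 : R).
  rewrite -(mulr0 C); apply: cvgMr; exact: cvg_harmonic.
have cvR : (fun n => n.+1%:R^-1 * rv_entropy nu (block n.+1 (orbit_rv Z)) +
    C * n.+1%:R^-1 + e : R) @ \oo --> entropy_rate nu Z + e.
  apply: cvgD; last exact: cvg_cst.
  rewrite -[X in _ --> X]addr0; apply: cvgD => //.
  by rewrite (cvg_shiftS (fun n => n%:R^-1 * rv_entropy nu (block n (orbit_rv Z)))).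
have cvY' : (fun n => n.+1%:R^-1 * rv_entropy mu (block n.+1 (orbit_rv Y))) @ \oo
    --> entropy_rate mu Y.
  by rewrite (cvg_shiftS (fun n => n%:R^-1 * rv_entropy mu (block n (orbit_rv Y)))).
rewrite -(cvg_lim (@Rhausdorff R) cvR) -(cvg_lim (@Rhausdorff R) cvY').
apply: ler_lim; [exact: cvgP cvY'|exact: cvgP cvR|].
near=> n; rewrite -(@ler_pM2l _ n.+1%:R)// !mulrDr !mulVKf//.
by rewrite [X in _ + X + _]mulrCA divff// mulr1; exact: le_YZ.
Unshelve. all: by end_near. Qed.

(** The cells of the dynamical join are the fibres of the block map. *)
Lemma entropy_wrtE mu k (Y : X -> 'I_k) :
  entropy_wrt f mu (fun i => Y @^-1` [set i]) = entropy_rate mu Y.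
Proof.
rewrite /entropy_wrt /entropy_rate; congr (lim (_ @ \oo)); apply/funext => n.
congr (_ * _); rewrite /rv_entropy /entropy /partition_entropy /pmf.
by under [in RHS]eq_bigr do rewrite block_preimage.
Qed.

Lemma measurable_partitionE k (A : 'I_k -> set X) : measurable_partition A ->
  exists2 Y : X -> 'I_k, finite_rv Y & A = fun i => Y @^-1` [set i].
Proof.
move=> [mA tA cA].
have /choice[Y YA] : forall x, exists i, A i x.
  by move=> x; have : setT x by []; rewrite -cA => -[i _ Aix]; exists i.
have AE : A = fun i => Y @^-1` [set i].
  apply/funext => i; apply/seteqP; split=> [x Aix /=|x /= <-]; last exact: YA.
  by apply: (tA _ _ Logic.I Logic.I); exists x; split.
by exists Y => // i; have := mA i; rewrite AE.
Qed.

Lemma finite_rv_partition k (Y : X -> 'I_k) : finite_rv Y ->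
  measurable_partition (fun i => Y @^-1` [set i]).
Proof.
move=> mY; split=> //; first by move=> i j _ _ [x [/= <- <-]].
by apply/seteqP; split=> // x _; exists (Y x).
Qed.

End entropy_rate.

(** * Binary digits on the torus *)

Section torus_digits.
Variable R : realType.
Local Notation T := (torus R).
Local Notation dbl := (@doubling R).

Definition tpi (r : R) : T := \pi_(torus R)%qT r.

Lemma tpi_reprK (x : T) : tpi (repr x) = x.
Proof. exact: reprK. Qed.

Lemma tpiB (a b : R) : tpi (a - b) = tpi a - tpi b.
Proof. exact: torus_piB. Qed.

Lemma tpi0 : tpi 0 = 0.
Proof. by rewrite -(subrr (0 : R)) tpiB subrr. Qed.

Lemma tpiD (a b : R) : tpi (a + b) = tpi a + tpi b.
Proof. by rewrite -[b in LHS]opprK tpiB -(sub0r b) tpiB tpi0 sub0r opprK. Qed.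

Lemma eq_tpi (a b : R) : a - b \is a Num.int -> tpi a = tpi b.
Proof. by rewrite -torus_eqE => /eqP. Qed.

Lemma tpiP (a b : R) : tpi a = tpi b -> exists z : int, a = b + z%:~R.
Proof.
move=> /eqP; rewrite torus_eqE => /intrP[z zE]; exists z.
by rewrite -zE addrC subrK.
Qed.

Lemma tpiDz (a : R) (z : int) : tpi (a + z%:~R) = tpi a.
Proof. by apply: eq_tpi; rewrite addrAC subrr add0r intr_int. Qed.

Lemma doubling_tpi (a : R) : dbl (tpi a) = tpi (2 * a).
Proof. by rewrite /doubling mulr2n -tpiD mulr_natl mulr2n. Qed.

Lemma iter_doubling_tpi k (a : R) : iter k dbl (tpi a) = tpi (2 ^+ k * a).
Proof.
by elim: k => [|k IHk]; rewrite ?expr0 ?mul1r// iterS IHk doubling_tpi exprS mulrA.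
Qed.

(** [repr] returns an arbitrary representative; this one lies in [[0, 1)]. *)
Definition tfrac (x : T) : R := repr x - (Num.floor (repr x))%:~R.

Lemma tfrac_itv x : 0 <= tfrac x < 1.
Proof.
have := floor_itv (repr x); rewrite /tfrac subr_ge0 ltrBlDr intrD [1 + _]addrC.
exact.
Qed.

Lemma tfracK (x : T) : tpi (tfrac x) = x.
Proof. by rewrite /tfrac -mulrNz tpiDz tpi_reprK. Qed.

Lemma tfrac_tpi (r : R) : 0 <= r < 1 -> tfrac (tpi r) = r.
Proof.
move=> /andP[r0 r1]; have /andP[f0 f1] := tfrac_itv (tpi r).
have [z zE] := tpiP (tfracK (tpi r)).
have z_gt : (-1 < z)%R by rewrite -(ltr_int R) mulrNz; lra.
have z_lt : (z < 1)%R by rewrite -(ltr_int R); lra.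
have z0 : z = 0 by lia.
by rewrite zE z0 addr0.
Qed.

Definition digit0 (x : T) : bool := 2^-1 <= tfrac x.

Lemma tfrac_doubling x : tfrac (dbl x) = 2 * tfrac x - (digit0 x)%:R.
Proof.
have /andP[f0 f1] := tfrac_itv x.
rewrite -[RHS]tfrac_tpi; last first.
  by rewrite /digit0; case: (leP 2^-1 (tfrac x)) => h /=; apply/andP; split; lra.
rewrite -[x in LHS]tfracK doubling_tpi; congr tfrac.
by rewrite -(tpiDz _ (- (digit0 x)%:Z)) mulrNz.
Qed.

(** The binary expansion as an itinerary of the doubling map; dyadic points receive the expansion
    ending in zeros. *)
Definition digit : nat -> T -> bool := orbit_rv dbl digit0.

Lemma digit0E x : digit 0 x = digit0 x. Proof. by []. Qed.

Lemma digitS k x : digit k.+1 x = digit k (dbl x).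
Proof. by rewrite /digit /orbit_rv iterSr. Qed.

Definition word m : T -> {ffun 'I_m -> bool} := block m digit.

Lemma wordP m x y :
  (word m x = word m y) <-> (forall k, (k < m)%N -> digit k x = digit k y).
Proof.
split=> [wxy k km|h]; last by apply/ffunP => i; rewrite !ffunE; apply: h.
by have /ffunP/(_ (Ordinal km)) := wxy; rewrite !ffunE.
Qed.

Lemma tfrac_expansion m x : tfrac x =
  \sum_(k < m) (digit k x)%:R / 2 ^+ k.+1 + tfrac (iter m dbl x) / 2 ^+ m.
Proof.
elim: m x => [|m IHm] x; first by rewrite big_ord0 add0r expr0 divr1.
rewrite big_ord_recl /= -[dbl (iter m dbl x)]/(iter m.+1 dbl x) iterSr.
have -> : tfrac x = (tfrac (dbl x) + (digit0 x)%:R) / 2.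
  by rewrite tfrac_doubling subrK mulrC mulKf.
rewrite (IHm (dbl x)) [X in X / 2]addrC mulrDl digit0E expr1 -[RHS]addrA.
congr (_ + _); rewrite mulrDl mulr_suml; congr (_ + _).
  by apply: eq_bigr => k _; rewrite /= /bump /= add1n digitS -mulrA -invfM -exprSr.
by rewrite -mulrA -invfM -exprSr.
Qed.

Lemma word_tfrac_close m x y : word m x = word m y ->
  `|tfrac x - tfrac y| < (2 ^+ m)^-1.
Proof.
move=> /wordP wxy; rewrite (tfrac_expansion m x) (tfrac_expansion m y).
under eq_bigr do rewrite wxy//.
rewrite opprD addrACA subrr add0r -mulrBl normrM.
rewrite [X in _ * X]gtr0_norm ?invr_gt0 ?exprn_gt0// -[ltRHS]mul1r ltr_pM2r ?invr_gt0 ?exprn_gt0//.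
have /andP[? ?] := tfrac_itv (iter m dbl x).
have /andP[? ?] := tfrac_itv (iter m dbl y).
by rewrite ltr_norml; lra.
Qed.

Lemma open_torusE (U : set T) : open U = open (tpi @^-1` U).
Proof. by []. Qed.

Lemma open_tpi (U : set R) : open U -> open (tpi @` U).
Proof.
move=> oU; rewrite open_torusE.
rewrite (_ : _ @^-1` _ = \bigcup_(z : int) ((fun r : R => r + z%:~R) @^-1` U)).
  apply: bigcup_open => z _; apply: open_comp => // r _.
  by apply: cvgD; [exact: cvg_id|exact: cvg_cst].
apply/seteqP; split=> [r [s Us /tpiP[z zE]]|r [z _ Ur]].
  by exists z => //=; rewrite -zE.
by exists (r + z%:~R) => //; rewrite tpiDz.
Qed.

Lemma open_torus_measurable (U : set T) : open U -> measurable U.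
Proof. exact: sub_sigma_algebra. Qed.

Lemma measurable_tpi1 (r : R) : measurable [set tpi r].
Proof.
rewrite -[X in measurable X]setCK; apply: measurableC; apply: open_torus_measurable.
rewrite (_ : ~` _ = tpi @` `]r, r + 1[%classic).
  by apply: open_tpi; exact: itv_open.
apply/seteqP; split=> [x /= xr|x [s] /=].
  exists (r + tfrac (x - tpi r)); last by rewrite tpiD tfracK addrC subrK.
  have /andP[f0 f1] := tfrac_itv (x - tpi r).
  rewrite /= in_itv/= ltrD2l f1 andbT ltrDl lt_neqAle f0 andbT.
  apply/negP => /eqP f0'; apply: xr; have := tfracK (x - tpi r).
  by rewrite -f0' tpi0 => /esym/eqP; rewrite subr_eq0 => /eqP.
rewrite in_itv/= => /andP[rs sr] <- /tpiP[z zE].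
have z_gt : (0 < z)%R by rewrite -(ltr_int R); move: rs; rewrite zE; lra.
have z_lt : (z < 1)%R by rewrite -(ltr_int R); move: sr; rewrite zE; lra.
lia.
Qed.

(** The half circle [[1/2, 1)] is an open arc together with its left endpoint. *)
Lemma finite_rv_digit0 : finite_rv digit0.
Proof.
have mD : measurable [set x | digit0 x].
  rewrite (_ : [set x | digit0 x] = tpi @` `]2^-1, 1[%classic `|` [set tpi 2^-1]).
    apply: measurableU; last exact: measurable_tpi1.
    by apply: open_torus_measurable; apply: open_tpi; exact: itv_open.
  have h0 : 0 <= (2^-1 : R) < 1 by apply/andP; split; lra.
  apply/seteqP; split=> [x|x [[r /=]|/= ->]].
  - rewrite /= /digit0 le_eqVlt => /predU1P[->|h]; first by right; rewrite tfracK.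
    left; exists (tfrac x); last exact: tfracK.
    by rewrite /= in_itv/= h; have /andP[] := tfrac_itv x.
  - rewrite in_itv/= => /andP[r0 r1] <-; rewrite /= /digit0 tfrac_tpi; first exact: ltW.
    by apply/andP; split; lra.
  - by rewrite /digit0 tfrac_tpi.
case; first by rewrite (_ : _ @^-1` _ = [set x | digit0 x]).
rewrite (_ : _ @^-1` _ = ~` [set x | digit0 x]); first exact: measurableC.
by apply/seteqP; split=> x /=; case: digit0.
Qed.

Lemma measurable_torus_preimage (f : T -> T) :
  (forall U, open U -> measurable (f @^-1` U)) ->
  forall A, measurable A -> measurable (f @^-1` A).
Proof.
move=> fo A mA; rewrite -[X in measurable X]setTI.
have : measurable_fun setT f.
  apply: (@measurability _ _ T T setT f (@open T)) => // _ [U oU <-].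
  by rewrite setTI; exact: fo.
by apply.
Qed.

Lemma measurable_doubling A : measurable A -> measurable (dbl @^-1` A).
Proof.
apply: measurable_torus_preimage => U oU; apply: open_torus_measurable.
rewrite open_torusE (_ : _ @^-1` _ = (fun r : R => 2 * r) @^-1` (tpi @^-1` U)).
  apply: open_comp => // r _; apply: cvgM; [exact: cvg_cst|exact: cvg_id].
by apply/seteqP; split=> r /=; rewrite doubling_tpi.
Qed.

Lemma finite_rv_digit k : finite_rv (digit k).
Proof. apply: finite_rv_orbit; [exact: measurable_doubling|exact: finite_rv_digit0]. Qed.

Lemma finite_rv_word m : finite_rv (word m).
Proof. by apply: finite_rv_block => k; exact: finite_rv_digit. Qed.

(** The union of the dyadic cells of rank [m] contained in [U]. *)
Definition cell_interior m (U : set T) : set T :=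
  [set x | forall y, word m y = word m x -> U y].

Lemma cell_interiorE m U : cell_interior m U =
  word m @^-1` [set w | forall y, word m y = w -> U y].
Proof. by []. Qed.

(** Points of one cell of rank [m] have representatives less than [2 ^- m] apart, so small cells fit
    into balls. This reduces questions on Borel sets to finite words. *)
Lemma open_bigcup_cell_interior U : open U -> \bigcup_m cell_interior m U = U.
Proof.
move=> oU; apply/seteqP; split=> [x [m _]|x Ux]; first by apply.
have : nbhs (tfrac x) (tpi @^-1` U).
  by apply: open_nbhs_nbhs; split=> //=; rewrite tfracK.
move=> /nbhs_ballP[e /= e0 xU].
have [m me] : exists m, (2 ^+ m)^-1 < e.
  exists (Num.truncn e^-1).+1; rewrite invf_plt ?posrE ?exprn_gt0//.
  apply: lt_trans (_ : (Num.truncn e^-1).+1%:R < _).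
    by rewrite truncnS_gt ?realE ?invr_ge0 ?ltW.
  by rewrite -natrX ltr_nat ltn_expl.
exists m => // y /esym/word_tfrac_close xy; rewrite -(tfracK y).
by apply: (xU (tfrac y)); rewrite /ball /= (lt_trans xy).
Qed.

End torus_digits.

(** * Overwriting digits by a marker *)

Section binary_value.
Variable R : realType.
Implicit Types b : nat -> bool.
Local Notation dbl := (@doubling R).

Let partial b (m : nat) : R := \sum_(k < m) (b k)%:R / 2 ^+ k.+1.

Let partial_ge0 b m : 0 <= partial b m.
Proof. by apply: sumr_ge0 => k _; rewrite divr_ge0// exprn_ge0. Qed.

Let partial_le b m : partial b m <= 1 - (2 ^+ m)^-1.
Proof.
elim: m => [|m IHm]; first by rewrite /partial big_ord0 expr0 invr1 subrr.
rewrite /partial big_ord_recr/= -/(partial b m).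
have : (b m)%:R / 2 ^+ m.+1 <= (2 ^+ m.+1)^-1 :> R.
  by rewrite ler_piMl ?invr_ge0 ?exprn_ge0// lern1 leq_b1.
have a2 : (2 ^+ m)^-1 = 2 * (2 ^+ m.+1)^-1 :> R by rewrite exprS invfM mulVKf.
by move: IHm; rewrite a2; lra.
Qed.

Let partial_nondecreasing b : nondecreasing_seq (partial b).
Proof.
apply/nondecreasing_seqP => m; rewrite /partial big_ord_recr/= lerDl.
by rewrite divr_ge0// exprn_ge0.
Qed.

Let partial_le1 b m : partial b m <= 1.
Proof.
apply: le_trans (partial_le b m) _.
by rewrite gerBl invr_ge0 exprn_ge0.
Qed.

Definition binary_value b : R := limn (partial b).

Let partial_cvg b : cvgn (partial b).
Proof.
apply: nondecreasing_is_cvgn; first exact: partial_nondecreasing.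
by exists 1 => _ [m _ <-]; exact: partial_le1.
Qed.

Lemma binary_value_ge0 b : 0 <= binary_value b.
Proof.
by apply: limr_ge; [exact: partial_cvg|near=> m; exact: partial_ge0].
Unshelve. all: by end_near. Qed.

Lemma binary_value_le1 b : binary_value b <= 1.
Proof.
by apply: limr_le; [exact: partial_cvg|near=> m; exact: partial_le1].
Unshelve. all: by end_near. Qed.

Lemma binary_value_shift b :
  binary_value b = ((b 0%N)%:R + binary_value (fun k => b k.+1)) / 2.
Proof.
apply/cvg_lim => //; rewrite -cvg_shiftS /=.
rewrite (_ : (fun n => _) =
    fun n => ((b 0%N)%:R + partial (fun k => b k.+1) n) / 2); last first.
  apply/funext => n; rewrite /partial big_ord_recl /= expr1 mulrDl; congr (_ + _).
  rewrite mulr_suml; apply: eq_bigr => k _.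
  by rewrite /= /bump /= add1n -mulrA -invfM -exprSr.
apply: cvgM; last exact: cvg_cst.
by apply: cvgD; [exact: cvg_cst|exact: partial_cvg].
Qed.

Lemma binary_value_lt1 b k : b k = false -> binary_value b < 1.
Proof.
elim: k b => [|k IHk] b bk; rewrite binary_value_shift.
  by rewrite bk add0r; have := binary_value_le1 (fun k => b k.+1); lra.
have := IHk (fun k => b k.+1) bk.
have : (b 0%N)%:R <= 1 :> R by rewrite lern1 leq_b1.
lra.
Qed.

(** The leading digit becomes an integer after doubling, so no condition on [b] is involved. *)
Lemma doubling_binary_value b :
  dbl (tpi (binary_value b)) = tpi (binary_value (fun k => b k.+1)).
Proof.
rewrite doubling_tpi (binary_value_shift b) mulrCA divff// mulr1 addrC.
exact: (tpiDz _ (b 0%N)%:Z).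
Qed.

(** Infinitely many zeros keep the value of every tail below 1; a tail of ones would carry into the
    preceding digit. *)
Lemma digit_binary_value b : (forall n, exists2 k, (n <= k)%N & b k = false) ->
  forall k, digit k (tpi (binary_value b)) = b k.
Proof.
move=> b0 k; elim: k b b0 => [|k IHk] b b0; last first.
  rewrite digitS doubling_binary_value IHk// => n.
  have [[|k'] nk bk] := b0 n.+1; first by [].
  by exists k'.
rewrite digit0E /digit0 tfrac_tpi; last first.
  by rewrite binary_value_ge0; have [k _ /binary_value_lt1] := b0 0%N.
rewrite binary_value_shift; case: (b 0%N).
  have v0 := binary_value_ge0 (fun k => b k.+1).
  by case: leP => //= h; exfalso; move: h => /=; lra.
have [[|k'] // _ bk] := b0 1%N.
have v1 := @binary_value_lt1 (fun k => b k.+1) k' bk.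
by case: leP => //= h; exfalso; move: h => /=; lra.
Qed.

End binary_value.

(** * The overwriting maps *)

Section overwriting.
Variables (R : realType) (N l : nat) (s : nat -> bool).
Local Notation dbl := (@doubling R).
Hypothesis N_gt0 : (0 < N)%N.
Variable r0 : nat.
Hypotheses (r0l : (r0 < l)%N) (lN : (l <= N)%N) (sr0 : s r0 = false).

Definition overwrite j (b : nat -> bool) k : bool :=
  if ((k + j) %% N < l)%N then s ((k + j) %% N) else b k.

Definition insert_marker j (x : torus R) : torus R :=
  tpi (binary_value R (overwrite j (fun k => digit k x))).

(* The zero in the marker excludes expansions ending in ones, so that the digits
   of the new point are exactly the overwritten ones. *)
Lemma digit_insert_marker j x k :
  digit k (insert_marker j x) = overwrite j (fun i => digit i x) k.
Proof.
apply: digit_binary_value => n.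
(* This position is at least [n], and adding [j] gives [r0] modulo [N], where the marker has its
   zero. *)
exists (N * (n + j) + r0 - j)%N.
  rewrite leq_subRL; first by nia. by nia.
have jle : (j <= N * (n + j) + r0)%N by nia.
rewrite /overwrite subnK// mulnC modnMDl modn_small ?r0l//.
exact: leq_trans lN.
Qed.

Lemma insert_marker_doubling j x :
  dbl (insert_marker j x) = insert_marker j.+1 (dbl x).
Proof.
rewrite /insert_marker doubling_binary_value; congr (tpi (binary_value R _)).
by apply/funext => k; rewrite /overwrite addSnnS digitS.
Qed.

Lemma insert_marker_period : insert_marker N = insert_marker 0.
Proof.
apply/funext => x; congr (tpi (binary_value R _)).
by apply/funext => k; rewrite /overwrite modnDr addn0.
Qed.

Lemma word_insert_marker m j x :
  (forall k, (k < m)%N -> (l <= (k + j) %% N)%N) ->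
  word m (insert_marker j x) = word m x.
Proof.
move=> mj; apply/wordP => k km; rewrite digit_insert_marker /overwrite.
by rewrite ltnNge mj.
Qed.

(** The first [m] digits of the image are a function of the first [m] digits of [x], so preimages of
    unions of cells are unions of cells; open sets are countable unions of cells. *)
Lemma measurable_insert_marker j A :
  measurable A -> measurable (insert_marker j @^-1` A).
Proof.
apply: measurable_torus_preimage => U /open_bigcup_cell_interior <-.
rewrite preimage_bigcup; apply: bigcup_measurable => m _.
rewrite cell_interiorE -comp_preimage.
rewrite (_ : word m \o _ = (fun w : {ffun 'I_m -> bool} =>
    [ffun i : 'I_m => if ((i + j) %% N < l)%N then s ((i + j) %% N) else w i]
      : {ffun 'I_m -> bool}) \o @word R m).
  by apply: finite_rv_preimage; apply: finite_rv_comp; exact: finite_rv_word.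
apply/funext => x; apply/ffunP => i; rewrite !ffunE -/(digit i _).
by rewrite digit_insert_marker.
Qed.

End overwriting.

Lemma sum_shift_period (V : nmodType) (N : nat) (F : nat -> V) : F N = F 0%N ->
  \sum_(j < N) F j.+1 = \sum_(j < N) F j.
Proof.
case: N => [|N] FN; first by rewrite !big_ord0.
by rewrite big_ord_recr/= FN big_ord_recl addrC.
Qed.

Lemma sum_modn_shift (N k : nat) (F : nat -> nat) :
  (\sum_(j < N) F ((k + j) %% N) = \sum_(j < N) F j)%N.
Proof.
elim: k => [|k IHk]; first by apply: eq_bigr => j _; rewrite add0n modn_small.
rewrite -IHk -(@sum_shift_period _ N (fun j => F ((k + j) %% N)%N)).
  by apply: eq_bigr => j _; rewrite addSnnS.
by rewrite addn0 modnDr.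
Qed.

(** * Choice of the marker *)

Section marker_choice.
Variable R : realType.

Lemma floor_double (x : R) :
  Num.floor (2 * x) = Num.floor x * 2 + (digit0 (tpi x) : int).
Proof.
have /andP[f0 f1] := floor_itv x; rewrite intrD in f1.
have -> : digit0 (tpi x) = (2^-1 <= x - (Num.floor x)%:~R).
  rewrite /digit0 -[x in LHS](subrK (Num.floor x)%:~R) tpiDz tfrac_tpi//.
  by apply/andP; split; lra.
apply: floor_def; rewrite !intrD intrM.
by case: (leP 2^-1 (x - (Num.floor x)%:~R)) => h /=; apply/andP; split; lra.
Qed.

(** The integers below [floor u] are those [z] for which [z n] is below [floor (n u)]. *)
Lemma floor_inj_scale (n : nat) (x y : R) : (0 < n)%N ->
  Num.floor (n%:R * x) = Num.floor (n%:R * y) -> Num.floor x = Num.floor y.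
Proof.
move=> n0 nxy.
have H (z : int) (u : R) : (z <= Num.floor u) = (z * n%:Z <= Num.floor (n%:R * u)).
  by rewrite !floor_ge_int intrM mulrC ler_pM2l// ltr0n.
by apply/le_anti; rewrite H -nxy -H lexx H nxy -H lexx.
Qed.

(** The floor at scale [2 ^+ M] determines those at all coarser scales, and digit [k] is
    [floor (2 ^+ k.+1 * x)] minus twice [floor (2 ^+ k * x)]. *)
Lemma digit_floor M (x y : R) :
  Num.floor (2 ^+ M * x) = Num.floor (2 ^+ M * y) ->
  forall k, (k < M)%N -> digit k (tpi x) = digit k (tpi y).
Proof.
move=> fxy k kM.
have fk i : (i <= M)%N -> Num.floor (2 ^+ i * x) = Num.floor (2 ^+ i * y).
  move=> iM; apply: (@floor_inj_scale (2 ^ (M - i))%N); first by rewrite expn_gt0.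
  by rewrite natrX !mulrA -exprD subnK.
rewrite /digit /orbit_rv !iter_doubling_tpi.
have := fk k.+1 kM; rewrite !exprS -!mulrA !floor_double (fk _ (ltnW kM)).
by move=> /addrI; do 2!case: digit0.
Qed.

(* A ball of radius [2 ^- M] meets at most three consecutive dyadic intervals of
   rank [M], counted cyclically. *)
Lemma near_digits M (c : torus R) : exists (p : 'I_3 -> torus R) (U : set (torus R)),
  open_nbhs c U /\
  forall y, U y -> exists i, forall k, (k < M)%N -> digit k y = digit k (p i).
Proof.
have M0 : 0 < 2 ^+ M :> R by rewrite exprn_gt0.
pose f := Num.floor (2 ^+ M * tfrac c).
(* The left endpoints of the dyadic interval containing [c] and of its two neighbours; the
   projection [tpi] takes care of wrapping around 0. *)
exists (fun i => tpi ((f + i%:Z - 1)%:~R / 2 ^+ M)).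
exists (@tpi R @` `]tfrac c - (2 ^+ M)^-1, tfrac c + (2 ^+ M)^-1[%classic); split.
  split; first by apply: open_tpi; exact: itv_open.
  exists (tfrac c); last exact: tfracK.
  by rewrite /= in_itv/= gtrBl ltrDl invr_gt0 M0.
move=> y [r /=]; rewrite in_itv/= => /andP[cr rc] <-{y}.
have /andP[f0 f1] := floor_itv (2 ^+ M * tfrac c); rewrite -/f intrD in f0 f1.
have /andP[g0 g1] := floor_itv (2 ^+ M * r); rewrite intrD in g1.
set g := Num.floor (2 ^+ M * r) in g0 g1.
have r1 : 2 ^+ M * tfrac c - 1 < 2 ^+ M * r.
  by rewrite -(ltr_pM2l M0) mulrBr divff ?gt_eqF// in cr.
have r2 : 2 ^+ M * r < 2 ^+ M * tfrac c + 1.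
  by rewrite -(ltr_pM2l M0) mulrDr divff ?gt_eqF// in rc.
have gf1 : (f - 2 < g)%R by rewrite -(ltr_int R) intrB; lra.
have gf2 : (g < f + 2)%R by rewrite -(ltr_int R) intrD; lra.
have ilt : (absz (g - f + 1)%R < 3)%N by lia.
exists (Ordinal ilt) => k; apply: digit_floor => /=.
rewrite mulrCA divff ?gt_eqF// mulr1 intrKfloor -/g; lia.
Qed.

(* [3 * N] windows and the word of ones have to be avoided by [s]. *)
Lemma marker_word_exists (N l : nat) (v : 'I_N -> 'I_3 -> nat -> bool) :
  (3 * N + 1 < 2 ^ l)%N ->
  exists2 s : nat -> bool, (exists2 r, (r < l)%N & s r = false) &
  forall j i, exists2 r, (r < l)%N & s r <> v j i r.
Proof.
move=> Nl.
pose bad (o : option ('I_N * 'I_3)) : {ffun 'I_l -> bool} :=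
  if o is Some ji then [ffun r : 'I_l => v ji.1 ji.2 r] else [ffun=> true].
have [w wP] : exists w, w \notin codom bad.
  (* Otherwise [bad] would be onto, with at most [3 N + 1] values for [2 ^ l] words. *)
  apply/existsP; rewrite -negb_forall; apply/negP => /forallP all_bad.
  have := leq_image_card bad predT.
  have /eq_card-> : codom bad =i predT by move=> w; rewrite all_bad.
  rewrite card_ffun card_bool card_ord card_option card_prod !card_ord; lia.
pose s r := if insub r is Some i then w i else false : bool.
have sE (r : 'I_l) : s r = w r by rewrite /s valK.
have diff o : exists r : 'I_l, s r <> bad o r.
  apply: contrapT => h; move/negP: wP; apply; apply/codomP; exists o.
  apply/ffunP => r; apply: contrapT => wr; apply: h.
  by exists r; rewrite sE.
exists s => [|j i].
  have [r] := diff None; rewrite ffunE => sr; exists r => //.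
  by case: (s r) sr.
by have [r] := diff (Some (j, i)); rewrite ffunE => sr; exists r.
Qed.

(** For [j < N] the image of [insert_marker] carries the marker from position [N - j] on, at
    positions below [2 N] because [l <= N]. Inside the neighbourhood given by [near_digits] at rank
    [N + N], the marker would be a window of one of three fixed points; it is chosen different from
    all of these. *)
Lemma marker_exists (N l : nat) (c : torus R) :
  (l <= N)%N -> (3 * N + 1 < 2 ^ l)%N ->
  exists s : nat -> bool, (exists2 r, (r < l)%N & s r = false) /\
  exists2 U, open_nbhs c U &
    forall j x, (j < N)%N -> ~ U (insert_marker N l s j x).
Proof.
move=> lN Nl; have [p [U [cU Up]]] := near_digits (N + N) c.
have [s s0 sP] := marker_word_exists (fun j i r => digit (N - j + r) (p i)) Nl.
exists s; split=> //; exists U => // j x jN /Up[i yi].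
have [r rl sr] := sP (Ordinal jN) i; apply: sr => /=.
rewrite -yi; last by lia.
have [r0 r0l sr0] := s0.
rewrite (digit_insert_marker _ r0l)//; last by lia.
rewrite /overwrite addnAC subnK ?(ltnW jN)// modnDl modn_small ?rl//.
exact: leq_trans lN.
Qed.

End marker_choice.

(** * Averages of image measures *)

Section average_law.
Context d (X : measurableType d) (R : realType) (mu : probability X R).
Variables (g : nat -> X -> X) (mg : forall j, measurable_fun setT (g j)).
Variables (N : nat) (N_gt0 : (0 < N)%N).

Let G j : {mfun X >-> X} := HB.pack (g j) (isMeasurableFun.Build _ _ _ _ _ (mg j)).

Let invN_ge0 : 0 <= N%:R^-1 :> R. Proof. by rewrite invr_ge0. Qed.

(** The law of [g j x] for [x] of law [mu] and an independent [j] uniform below [N]. *)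
Definition average_law : set X -> \bar R :=
  mscale (NngNum invN_ge0) (msum (fun j => distribution mu (G j)) N).

HB.instance Definition _ := Measure.on average_law.

Lemma average_lawE A :
  average_law A = (N%:R^-1%:E * \sum_(j < N) mu (g j @^-1` A))%E.
Proof. by []. Qed.

Let average_law_setT : average_law setT = 1%E.
Proof.
rewrite average_lawE (eq_bigr (fun=> 1%:E)) => [|j _].
  by rewrite sumEFin sumr_const card_ord -EFinM mulVf// pnatr_eq0 -lt0n.
by rewrite preimage_setT probability_setT.
Qed.

HB.instance Definition _ := Measure_isProbability.Build _ _ _
  average_law average_law_setT.

Definition average_probability : probability X R := average_law.

Lemma average_probabilityE A :
  average_probability A = (N%:R^-1%:E * \sum_(j < N) mu (g j @^-1` A))%E.
Proof. by []. Qed.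

Lemma finite_rv_average_comp (I : finType) (Y : X -> I) j :
  finite_rv Y -> finite_rv (Y \o g j).
Proof.
move=> mY i; rewrite comp_preimage -[X in measurable X]setTI.
by apply: mg => //; exact: mY.
Qed.

Lemma pmf_average (I : finType) (Y : X -> I) : finite_rv Y ->
  pmf average_probability Y = fun i => \sum_(j < N) N%:R^-1 * pmf mu (Y \o g j) i.
Proof.
move=> mY; apply/funext => i; rewrite /pmf average_probabilityE.
by rewrite -mulr_sumr -EFin_sum_fine// => j _;
  rewrite fin_num_measure//; exact: finite_rv_average_comp.
Qed.

(** The law of [Y] under the average is the average of the laws of [Y \o g j], and entropy is
    concave. *)
Lemma rv_entropy_average (I : finType) (Y : X -> I) : finite_rv Y ->
  \sum_(j < N) N%:R^-1 * rv_entropy mu (Y \o g j)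
  <= rv_entropy average_probability Y.
Proof.
move=> mY; rewrite {2}/rv_entropy pmf_average//.
apply: (@entropy_concave _ I 'I_N (fun=> N%:R^-1) (fun j => pmf mu (Y \o g j))).
- by move=> _; rewrite invr_ge0.
- by move=> j i; exact: pmf_ge0.
- by rewrite sumr_const card_ord -[_ *+ _]mulr_natr mulVf// pnatr_eq0 -lt0n.
Qed.

Lemma integral_average (f : X -> \bar R) : measurable_fun setT f ->
  (forall x, 0 <= f x)%E ->
  (\int[average_probability]_x f x =
   N%:R^-1%:E * \sum_(j < N) \int[mu]_x f (g j x))%E.
Proof.
move=> mf f0.
rewrite [LHS]ge0_integral_mscale// ge0_integral_measure_sum//=; congr (_ * _)%E.
by apply: eq_bigr => j _; rewrite ge0_integral_pushforward//.
Qed.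

End average_law.

(** * Approximation by dyadic partitions *)

Section real_probability.
Context d (X : measurableType d) (R : realType) (mu : probability X R).
Local Notation P A := (fine (mu A)).

Lemma fine_measure_le (A B : set X) : measurable A -> measurable B ->
  A `<=` B -> P A <= P B.
Proof.
move=> mA mB AB; rewrite fine_le ?fin_num_measure//.
by apply: le_measure; rewrite ?inE.
Qed.

Lemma fine_measureU_le (A B : set X) : measurable A -> measurable B ->
  P (A `|` B) <= P A + P B.
Proof.
move=> mA mB; rewrite -fineD ?fin_num_measure// fine_le ?fin_num_measure//.
- exact: measurableU.
- by rewrite fin_numD !fin_num_measure.
- exact: measureU2.
Qed.

Lemma fine_measure_le_sum k (A : set X) (B : 'I_k -> set X) :
  measurable A -> (forall i, measurable (B i)) ->
  (forall x, A x -> exists i, B i x) -> P A <= \sum_i P (B i).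
Proof.
move=> mA mB AB.
have mU (r : seq 'I_k) : measurable (\big[setU/set0]_(i <- r) B i).
  by elim/big_ind: _ => // U V; exact: measurableU.
apply: (@le_trans _ _ (P (\big[setU/set0]_(i < k) B i))).
  by apply: fine_measure_le => // x /AB[i Bi]; rewrite (bigD1 i)//=; left.
elim: (index_enum _) => [|i r IHr]; first by rewrite !big_nil measure0.
rewrite !big_cons; apply: le_trans (fine_measureU_le (mB i) (mU r)) _.
by rewrite lerD2l.
Qed.

Lemma fine_measure_bigcup_approx (F : nat -> set X) (e : R) :
  (forall n, measurable (F n)) -> nondecreasing_seq F -> 0 < e ->
  exists n, P ((\bigcup_n F n) `\` F n) < e.
Proof.
move=> mF ndF e0.
have mU : measurable (\bigcup_n F n) by exact: bigcup_measurable.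
have : mu \o F @ \oo --> (P (\bigcup_n F n))%:E.
  by rewrite fineK ?fin_num_measure//; exact: nondecreasing_cvg_mu.
move=> /fine_cvg/cvgrPdist_lt/(_ _ e0)[n _ /(_ n (leqnn n)) /= Pn]; exists n.
rewrite measureD//; last by rewrite ltey_eq fin_num_measure.
rewrite setIidr; last exact: bigcup_sup.
rewrite fineB ?fin_num_measure//; exact: le_lt_trans (ler_norm _) Pn.
Qed.

End real_probability.

Section dyadic_approximation.
Variables (R : realType) (mu : probability (torus R) R).
Local Notation T := (torus R).
Local Notation dbl := (@doubling R).
Local Notation P A := (fine (mu A)).

(** Unions of dyadic cells of rank [m], described by saturation so that Boolean operations and
    refinement are immediate. *)
Definition cylinder m (B : set T) :=
  forall x y, word m x = word m y -> B x -> B y.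

Lemma measurable_cylinder m B : cylinder m B -> measurable B.
Proof.
move=> cB; rewrite (_ : B = @word R m @^-1` (@word R m @` B)).
  exact: finite_rv_preimage (@finite_rv_word R m) _.
apply/seteqP; split=> x /=; first by exists x.
by move=> [y By /cB]; exact.
Qed.

Lemma cylinder_le m n B : (m <= n)%N -> cylinder m B -> cylinder n B.
Proof.
move=> mn cB x y /wordP xy; apply: cB; apply/wordP => k km.
by apply: xy; exact: leq_trans mn.
Qed.

Lemma cylinderC m B : cylinder m B -> cylinder m (~` B).
Proof. by move=> cB x y xy nBx By; apply: nBx; exact: cB (esym xy) By. Qed.

Lemma cylinderU m A B : cylinder m A -> cylinder m B -> cylinder m (A `|` B).
Proof. by move=> cA cB x y xy [/(cA _ _ xy)|/(cB _ _ xy)]; [left|right]. Qed.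

Lemma cylinder_cell_interior m U : cylinder m (cell_interior m U).
Proof. by move=> x y xy h z zy; apply: h; rewrite zy xy. Qed.

Definition symdiff (A B : set T) := (A `\` B) `|` (B `\` A).

Lemma measurable_symdiff A B : measurable A -> measurable B ->
  measurable (symdiff A B).
Proof. by move=> mA mB; apply: measurableU; exact: measurableD. Qed.

Definition approximable (A : set T) := measurable A /\
  forall e, 0 < e -> exists m, exists2 B, cylinder m B & P (symdiff A B) < e.

Lemma approximable_cylinder m B : cylinder m B -> approximable B.
Proof.
move=> cB; split=> [|e e0]; first exact: measurable_cylinder cB.
by exists m, B => //; rewrite /symdiff setDv setU0 measure0.
Qed.

Lemma approximableC A : approximable A -> approximable (~` A).
Proof.
move=> [mA aA]; split=> [|e /aA[m [B cB PB]]]; first exact: measurableC.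
exists m, (~` B); first exact: cylinderC.
rewrite (_ : symdiff _ _ = symdiff A B)//; apply/seteqP.
by split=> x; rewrite /symdiff /=;
  have [?|?] := pselect (A x); have [?|?] := pselect (B x); tauto.
Qed.

Lemma approximableU A A' : approximable A -> approximable A' ->
  approximable (A `|` A').
Proof.
move=> [mA aA] [mA' aA']; split=> [|e e0]; first exact: measurableU.
have e20 : 0 < e / 2 by rewrite divr_gt0.
have [m [B cB PB]] := aA _ e20; have [m' [B' cB' PB']] := aA' _ e20.
have mB := measurable_cylinder cB; have mB' := measurable_cylinder cB'.
exists (maxn m m'), (B `|` B').
  by apply: cylinderU; [apply: cylinder_le cB|apply: cylinder_le cB'];
    rewrite ?leq_maxl ?leq_maxr.
have mS := measurable_symdiff mA mB; have mS' := measurable_symdiff mA' mB'.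
apply: le_lt_trans (_ : P (symdiff A B `|` symdiff A' B') < _).
  apply: fine_measure_le; last 1 first.
  - move=> x; rewrite /symdiff /=.
    have [?|?] := pselect (A x); have [?|?] := pselect (B x);
    have [?|?] := pselect (A' x); have [?|?] := pselect (B' x); tauto.
  - by apply: measurable_symdiff; exact: measurableU.
  - exact: measurableU.
by apply: le_lt_trans (fine_measureU_le _ mS mS') _; rewrite (splitr e) ltrD.
Qed.

(** By continuity from below some [F n] is close to the union, and a cylinder close to [F n] then
    serves. *)
Lemma approximable_nondecreasing (F : nat -> set T) :
  nondecreasing_seq F -> (forall n, approximable (F n)) ->
  approximable (\bigcup_n F n).
Proof.
move=> ndF aF; have mF n : measurable (F n) by have [] := aF n.
have mU : measurable (\bigcup_n F n) by exact: bigcup_measurable.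
split=> // e e0; have e20 : 0 < e / 2 by rewrite divr_gt0.
have [n Pn] := fine_measure_bigcup_approx mu mF ndF e20.
have [_ /(_ _ e20)[m [B cB PB]]] := aF n; exists m, B => //.
have mB := measurable_cylinder cB; have mS := measurable_symdiff (mF n) mB.
have mD := measurableD mU (mF n).
apply: le_lt_trans (_ : P (((\bigcup_n F n) `\` F n) `|` symdiff (F n) B) < _).
  apply: fine_measure_le; [exact: measurable_symdiff|exact: measurableU|].
  move=> x; have [Fx|nFx] := pselect (F n x).
    by move=> [[_ nBx]|[Bx nUx]]; right; [left|case: nUx; exists n].
  by move=> [[Ux nBx]|[Bx nUx]]; [left|right; right].
by apply: le_lt_trans (fine_measureU_le _ mD mS) _; rewrite (splitr e) ltrD.
Qed.

Lemma approximable_bigcup (F : nat -> set T) :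
  (forall n, approximable (F n)) -> approximable (\bigcup_n F n).
Proof.
move=> aF; pose G n := [set x | exists2 i, (i < n)%N & F i x].
rewrite (_ : \bigcup_n F n = \bigcup_n G n); last first.
  apply/seteqP; split=> [x [n _ Fx]|x [n _ [i _ Fx]]]; last by exists i.
  by exists n.+1 => //; exists n.
apply: approximable_nondecreasing => [m n mn|n].
  by apply/subsetPset => x [i im Fx]; exists i => //; exact: leq_trans mn.
elim: n => [|n IHn].
  rewrite (_ : G 0%N = set0); first by apply: (@approximable_cylinder 0).
  by apply/seteqP; split=> // x [].
rewrite (_ : G n.+1 = G n `|` F n); first exact: approximableU.
apply/seteqP; split=> [x [i]|x [[i im Fx]|Fx]].
- rewrite ltnS leq_eqVlt => /predU1P[->|im]; [by right|].
  by left; exists i.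
- by exists i => //; exact: ltnW.
- by exists n.
Qed.

(** The approximable sets form a sigma-algebra, which contains the open sets since these are
    countable unions of cylinders. *)
Lemma measurable_approximable A : measurable A -> approximable A.
Proof.
have sA : sigma_algebra setT approximable.
  split=> [|B aB|F aF]; first by apply: (@approximable_cylinder 0).
  - by rewrite setTD; exact: approximableC.
  - exact: approximable_bigcup.
have oA : @open T `<=` approximable.
  move=> U /open_bigcup_cell_interior <-; apply: approximable_bigcup => m.
  exact: approximable_cylinder (@cylinder_cell_interior m U).
by move/(smallest_sub sA oA).
Qed.

(** Each fibre of [Y] is approximated by a cylinder [B i], and [h] selects an [i] whose cylinder
    contains the given cell. Outside all the symmetric differences, [Y x] is the only such index. *)
Lemma finite_rv_approximation k (Y : T -> 'I_k) (e : R) : finite_rv Y -> 0 < e ->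
  exists m (h : {ffun 'I_m -> bool} -> 'I_k),
    P [set x | Y x <> h (word m x)] < e.
Proof.
move=> mY e0.
(* With [k.+1] the sum of the [k] errors stays strictly below [e]. *)
have ek0 : 0 < e / k.+1%:R by rewrite divr_gt0.
have /choice[mB mBP] : forall i, exists mB : nat * set T,
    cylinder mB.1 mB.2 /\ P (symdiff (Y @^-1` [set i]) mB.2) < e / k.+1%:R.
  move=> i; have [_ /(_ _ ek0)[m [B cB PB]]] := measurable_approximable (mY i).
  by exists (m, B).
pose m := \max_i (mB i).1; pose B i := (mB i).2.
have cB i : cylinder m (B i).
  have [+ _] := mBP i; apply: cylinder_le.
  by rewrite /m (bigD1 i)//= leq_maxl.
pose h (w : {ffun 'I_m -> bool}) : 'I_k :=
  (* The default concerns cells outside every [B i]; their points all lie in a symmetric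
     difference. *)
  odflt (Y 0) [pick i | `[< exists2 x, word m x = w & B i x >]].
have hE x i : `[< exists2 y, word m y = word m x & B i y >] = `[< B i x >].
  by apply/asboolP/asboolP => [[y /cB]|Bx]; [exact|exists x].
exists m, h.
have mYh : measurable [set x | Y x <> h (word m x)].
  have := finite_rv_pair mY (@finite_rv_comp _ _ _ _ h _ (@finite_rv_word R m)).
  move=> /finite_rv_preimage/(_ [set yz | yz.1 <> yz.2]).
  by apply.
have mS i : measurable (symdiff (Y @^-1` [set i]) (B i)).
  by apply: measurable_symdiff; [exact: mY|exact: measurable_cylinder (cB i)].
apply: le_lt_trans (fine_measure_le_sum mu mYh mS _) _.
  move=> x /= Yh; apply: contrapT => nS; apply: Yh.
  have YB i : Y x = i <-> B i x.
    split=> h1; apply: contrapT => h2; apply: nS; exists i; [left|right]; split=> //.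
  rewrite /h; case: pickP => [i|/(_ (Y x))]; rewrite hE; first by move=> /asboolP/YB.
  by move=> /asboolP; have [/(_ erefl)] := YB (Y x).
apply: (@le_lt_trans _ _ (\sum_(i < k) e / k.+1%:R)).
  by apply: ler_sum => i _; rewrite ltW//; have [] := mBP i.
rewrite sumr_const card_ord -[_ *+ _]mulr_natl mulrCA gtr_pMr//.
by rewrite ltr_pdivrMr// mul1r ltr_nat.
Qed.

End dyadic_approximation.

(** * Entropy and integrals under marker insertion *)

Section entropy_comparison.
Variables (R : realType) (mu : probability (torus R) R).
Local Notation T := (torus R).
Local Notation dbl := (@doubling R).
Hypothesis mu_inv : forall A, measurable A -> mu (dbl @^-1` A) = mu A.

Lemma rv_entropy_orbit (I : finType) (Y : T -> I) i : finite_rv Y ->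
  rv_entropy mu (orbit_rv dbl Y i) = rv_entropy mu Y.
Proof.
by move=> mY; rewrite /rv_entropy pmf_iter//; exact: measurable_doubling.
Qed.

(** The [n] successive windows of length [m] are read inside the first [n + m] digits, so the window
    length costs only a constant. *)
Lemma rv_entropy_block_word_le (I : finType) m n (h : {ffun 'I_m -> bool} -> I) :
  rv_entropy mu (block n (orbit_rv dbl (h \o @word R m))) <=
  rv_entropy mu (block n (@digit R)) + rv_entropy mu (block m (@digit R)).
Proof.
pose get (w : {ffun 'I_(n + m) -> bool}) a : bool :=
  if insub a is Some o then w o else false.
have getE x a : (a < n + m)%N -> get (word (n + m) x) a = digit a x.
  by move=> anm; rewrite /get insubT ffunE.
pose window (w : {ffun 'I_(n + m) -> bool}) : {ffun 'I_n -> I} :=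
  [ffun i : 'I_n => h [ffun k : 'I_m => get w (i + k)%N]].
rewrite (_ : block n _ = window \o @word R (n + m)).
  apply: le_trans (rv_entropy_comp_le mu window (@finite_rv_word R (n + m))) _.
  apply: rv_entropy_orbit_add => //; first exact: measurable_doubling.
  exact: finite_rv_digit0.
apply/funext => x; apply/ffunP => i; rewrite !ffunE /orbit_rv /=; congr h.
apply/ffunP => k; rewrite !ffunE getE; last by move: (ltn_ord i) (ltn_ord k); lia.
by rewrite /digit /orbit_rv addnC iterD.
Qed.

(** The binary partition generates: [Y] agrees with a function [Z] of finitely many digits off a
    small set, and correcting [Z] into [Y] costs at most [e] per step. Hence the digits alone give
    the full entropy. *)
Lemma entropy_rate_le_digit0 k (Y : T -> 'I_k) (e : R) : finite_rv Y -> 0 < e ->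
  entropy_rate dbl mu Y <= entropy_rate dbl mu (@digit0 R) + e.
Proof.
move=> mY e0.
have c0 : 0 < 1 + 2 * k%:R :> R by rewrite ltr_wpDr// mulr_ge0.
(* Chosen so that the bound [s ^+ 2 + k * (2 * s)] for the entropy of the corrections is at most
   [e]. *)
pose s := Num.min 1 (e / (1 + 2 * k%:R)).
have s0 : 0 < s by rewrite lt_min ltr01 divr_gt0.
have s1 : s <= 1 by rewrite ge_min lexx.
have se : s * (1 + 2 * k%:R) <= e by rewrite -ler_pdivlMr// ge_min lexx orbT.
have se' : s ^+ 2 + k%:R * (2 * s) <= e.
  apply: le_trans se; rewrite mulrDr mulr1; apply: lerD.
    by rewrite expr2 ler_piMr// ltW.
  by rewrite mulrC -mulrA mulrCA mulrA.
have [m [h hP]] := finite_rv_approximation mu mY (exprn_gt0 2 s0).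
pose Z := h \o @word R m.
have mZ : finite_rv Z by apply: finite_rv_comp; exact: finite_rv_word.
(* The correction: [Y] is recovered from [Z] and [E], and [E] is rarely different from [None]. *)
pose E x := if Y x == Z x then None else Some (Y x).
have mE : finite_rv E.
  have := @finite_rv_comp _ _ _ _ (fun yz => if yz.1 == yz.2 then None else Some yz.1)
    _ (finite_rv_pair mY mZ).
  exact.
have HE : rv_entropy mu E <= e.
  apply: le_trans se'; rewrite -[k in leRHS]card_ord.
  apply: rv_entropy_option_small; rewrite ?(ltW s0)//.
  apply: le_trans (ltW hP).
  have -> : [set x | Y x <> h (word m x)] = ~` (E @^-1` [set None]).
    apply/seteqP; rewrite /E; split=> x /=.
      by move=> YZ; case: eqP => // /YZ.
    by move=> + YZ; apply; rewrite YZ eqxx.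
  by rewrite probability_setC// fineB// fin_num_measure.
apply: (@le_trans _ _ (entropy_rate dbl mu (@digit0 R) + rv_entropy mu E)); last first.
  by rewrite lerD2l.
apply: (@entropy_rate_le _ _ _ _ _ mu mu _ _ Y (@digit0 R)
    (rv_entropy mu (block m (@digit R)))) => //.
- exact: measurable_doubling.
- exact: finite_rv_digit0.
move=> n; apply: le_trans (_ : rv_entropy mu (block n (orbit_rv dbl Z)) +
    n%:R * rv_entropy mu E <= _); last first.
  by rewrite lerD2r; exact: rv_entropy_block_word_le.
pose g (i : nat) (ze : 'I_k * option 'I_k) := odflt ze.1 ze.2.
rewrite (_ : orbit_rv dbl Y =
    fun i x => g i (orbit_rv dbl Z i x, orbit_rv dbl E i x)); last first.
  apply/funext => i; apply/funext => x; rewrite /orbit_rv /g /E /=.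
  by case: eqP.
apply: le_trans (rv_entropy_block_correction mu n g _ _) _.
- by move=> i; apply: finite_rv_orbit => //; exact: measurable_doubling.
- by move=> i; apply: finite_rv_orbit => //; exact: measurable_doubling.
rewrite lerD2l; under eq_bigr do rewrite rv_entropy_orbit//.
by rewrite sumr_const card_ord mulr_natl.
Qed.

End entropy_comparison.

(** * The averaged measure: invariance, support, entropy and integrals *)

Section marker_measure.
Variables (R : realType) (mu : probability (torus R) R).
Local Notation T := (torus R).
Local Notation dbl := (@doubling R).
Hypothesis mu_inv : forall A, measurable A -> mu (dbl @^-1` A) = mu A.
Variables (N l : nat) (s : nat -> bool) (r0 : nat).
Hypotheses (N_gt0 : (0 < N)%N) (r0l : (r0 < l)%N) (lN : (l <= N)%N).
Hypothesis sr0 : s r0 = false.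
Local Notation g := (@insert_marker R N l s).

Lemma measurable_fun_insert_marker j : measurable_fun setT (g j).
Proof.
by move=> _ A mA; rewrite setTI; exact: (measurable_insert_marker N_gt0 r0l lN sr0).
Qed.

Definition marker_measure : probability T R :=
  average_probability mu measurable_fun_insert_marker N_gt0.
Local Notation nu := marker_measure.

(** Doubling raises the phase by one, which permutes the phases cyclically because phases [N] and 0
    coincide. *)
Lemma marker_measure_invariant A : measurable A -> nu (dbl @^-1` A) = nu A.
Proof.
move=> mA; rewrite !average_probabilityE; congr (_ * _)%E.
rewrite -(@sum_shift_period _ N (fun j => mu (g j @^-1` A))).
  apply: eq_bigr => j _; rewrite -[RHS]mu_inv; last first.
    exact: (measurable_insert_marker N_gt0 r0l lN sr0).
  congr (mu _); apply/seteqP.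
  by split=> x /=; rewrite insert_marker_doubling.
by rewrite insert_marker_period.
Qed.

Lemma marker_measure_support c U : open_nbhs c U ->
  (forall j x, (j < N)%N -> ~ U (g j x)) -> ~ topological_support nu c.
Proof.
move=> cU avoid /(_ U cU); rewrite average_probabilityE big1 ?mule0 ?ltxx//.
move=> j _; rewrite (_ : _ @^-1` _ = set0) ?measure0//.
by apply/seteqP; split=> // x /=; exact: avoid.
Qed.

Lemma sum_overwritten k : (\sum_(j < N) ((k + j) %% N < l) = l)%N.
Proof.
rewrite (sum_modn_shift N k (fun r => (r < l)%N : nat)) -big_mkcond /=.
by rewrite (big_ord_narrow lN) sum1_card card_ord.
Qed.

(** The original digits are recovered from the overwritten ones and from corrections [E k], which
    hold the lost digit, at a cost of at most [ln 2], at overwritten positions and are constant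
    elsewhere. *)
Lemma rv_entropy_block_overwrite n j :
  rv_entropy mu (block n (@digit R)) <=
  rv_entropy mu (block n (@digit R) \o g j) +
  \sum_(k < n) ((k + j) %% N < l)%N%:R * ln 2.
Proof.
pose E k : T -> option bool :=
  if ((k + j) %% N < l)%N then Some \o digit k else fun=> None.
pose f (k : nat) (be : bool * option bool) := odflt be.1 be.2.
have mE k : finite_rv (E k).
  rewrite /E; case: ifP => _.
    exact: (@finite_rv_comp _ _ _ _ Some _ (@finite_rv_digit R k)).
  by apply: (@finite_rv_comp _ _ _ _ (fun=> None) _ (@finite_rv_digit R k)).
have HE k : rv_entropy mu (E k) <= ((k + j) %% N < l)%N%:R * ln 2.
  rewrite /E; case: ifP => _.
    apply: le_trans (rv_entropy_comp_le mu Some (@finite_rv_digit R k)) _.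
    apply: le_trans (rv_entropy_le_ln_card mu (@finite_rv_digit R k)) _.
    by rewrite card_bool mul1r.
  have mtt : finite_rv (fun _ : T => tt).
    by apply: (@finite_rv_comp _ _ _ _ (fun=> tt) _ (@finite_rv_digit R k)).
  apply: le_trans (rv_entropy_comp_le mu (fun=> None) mtt) _.
  apply: le_trans (rv_entropy_le_ln_card mu mtt) _.
  by rewrite card_unit ln1 mul0r.
have mY k : finite_rv (@digit R k \o g j).
  by apply: (finite_rv_average_comp measurable_fun_insert_marker); exact: finite_rv_digit.
rewrite (_ : block n (@digit R) \o g j = block n (fun k => @digit R k \o g j))//.
rewrite {1}(_ : @digit R = fun k x => f k ((@digit R k \o g j) x, E k x)).
  apply: le_trans (rv_entropy_block_correction mu n f mY mE) _.
  by rewrite lerD2l; apply: ler_sum => k _; exact: HE.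
apply/funext => k; apply/funext => x; rewrite /f /E /=.
rewrite (digit_insert_marker N_gt0 r0l)// /overwrite.
by case: (_ < l)%N.
Qed.

(** The preceding bound is averaged over the phases. Each position is overwritten in exactly [l] of
    the [N] phases, so the average loss is [l / N * ln 2] per digit, and concavity passes to
    [nu]. *)
Lemma entropy_rate_marker_measure :
  entropy_rate dbl mu (@digit0 R) <=
  entropy_rate dbl nu (@digit0 R) + l%:R / N%:R * ln 2.
Proof.
have N0 : N%:R != 0 :> R by rewrite pnatr_eq0 -lt0n.
apply: (@entropy_rate_le _ _ _ _ _ mu nu _ _ (@digit0 R) (@digit0 R) 0) => //.
- exact: measurable_doubling.
- exact: marker_measure_invariant.
- exact: finite_rv_digit0.
- exact: finite_rv_digit0.
move=> n; rewrite addr0 -/(@digit R).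
apply: (@le_trans _ _ (\sum_(j < N) N%:R^-1 * (rv_entropy mu (block n (@digit R) \o g j) +
    \sum_(k < n) ((k + j) %% N < l)%N%:R * ln 2))).
  have -> : rv_entropy mu (block n (@digit R)) =
      \sum_(j < N) N%:R^-1 * rv_entropy mu (block n (@digit R)).
    by rewrite sumr_const card_ord -[RHS]mulr_natl mulrA mulfV// mul1r.
  apply: ler_sum => j _; rewrite ler_wpM2l// ?invr_ge0//.
  exact: rv_entropy_block_overwrite.
under eq_bigr do rewrite mulrDr.
rewrite big_split /=; apply: lerD.
  by apply: rv_entropy_average; exact: finite_rv_word.
rewrite -mulr_sumr exchange_big /= (eq_bigr (fun=> l%:R * ln 2)) => [|k _]; last first.
  by rewrite -mulr_suml -natr_sum sum_overwritten.
rewrite sumr_const card_ord -[X in _ * X]mulr_natl le_eqVlt; apply/orP; left; apply/eqP; ring.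
Qed.

(** A [good] phase leaves the first [m] digits untouched and reproduces the whole integral; the
    other phases contribute nonnegative terms. The subtraction is truncated, so the coefficient is 0
    when [m * l] exceeds [N]. *)
Lemma integral_marker_measure m (F : {ffun 'I_m -> bool} -> \bar R) :
  (forall w, 0 <= F w)%E ->
  (((N - m * l)%:R / N%:R)%:E * \int[mu]_x F (word m x) <=
   \int[nu]_x F (word m x))%E.
Proof.
move=> F0.
have mF : measurable_fun setT (fun x => F (@word R m x)).
  by move=> _ B mB; rewrite setTI; apply: (finite_rv_preimage (@finite_rv_word R m) (F @^-1` B)).
rewrite integral_average//.
pose good (j : 'I_N) := [forall k : 'I_m, (l <= (k + j) %% N)%N].
set I := (\int[mu]_x F (word m x))%E.
have I0 : (0 <= I)%E by apply: integral_ge0.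
have ngood : (N - m * l <= \sum_(j < N) good j)%N.
  (* Union bound: a phase that is not good overwrites one of the first [m] positions, and each
     position accounts for [l] phases. *)
  have : (\sum_(j < N) (1 : nat) <= \sum_(j < N) (good j + \sum_(k < m) ((k + j) %% N < l)))%N.
    apply: leq_sum => j _; rewrite /good.
    have [//|/forallPn[k]] := boolP [forall k : 'I_m, (l <= (k + j) %% N)%N].
    by rewrite -ltnNge add0n (bigD1 k)//= => ->.
  rewrite big_split /= exchange_big /= sum1_card card_ord.
  by under [X in (_ <= _ + X)%N]eq_bigr do rewrite sum_overwritten;
    rewrite sum_nat_const card_ord; lia.
rewrite mulrC EFinM -muleA; apply: lee_wpmul2l; first by rewrite lee_fin invr_ge0.
apply: (@le_trans _ _ (\sum_(j < N) (good j)%:R%:E * I)%E).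
  rewrite -ge0_sume_distrl// sumEFin; apply: lee_wpmul2r => //.
  by rewrite lee_fin -natr_sum ler_nat.
apply: lee_sum => j _; rewrite /good.
have [/forallP gj|_] := boolP [forall k : 'I_m, (l <= (k + j) %% N)%N]; last first.
  by rewrite mul0e integral_ge0.
rewrite mul1e /I le_eqVlt; apply/orP; left; apply/eqP; apply: eq_integral => x _.
rewrite (word_insert_marker N_gt0 r0l)// => k km.
exact: (gj (Ordinal km)).
Qed.

End marker_measure.

(** * The potential and its dyadic lower envelopes *)

Section lower_envelope.
Variables (R : realType) (f : torus R -> \bar R).
Local Notation T := (torus R).
Local Open Scope ereal_scope.
Hypothesis f_ge0 : forall x, 0 <= f x.
Hypothesis f_lsc : forall r : R, open [set x | r%:E < f x].

Definition cell_inf m (w : {ffun 'I_m -> bool}) : \bar R :=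
  ereal_inf [set f y | y in [set y | @word R m y = w]].

Lemma cell_inf_ge0 m w : 0 <= @cell_inf m w.
Proof. by apply: le_ereal_inf_tmp => _ [y _ <-]. Qed.

Lemma cell_inf_le m x : cell_inf (@word R m x) <= f x.
Proof. by apply: ereal_inf_lbound; exists x. Qed.

Lemma cell_inf_nondecreasing x : nondecreasing_seq (fun m => cell_inf (@word R m x)).
Proof.
move=> m n mn; apply: le_ereal_inf_tmp => _ [y yx <-]; apply: ereal_inf_lbound.
exists y => //=; apply/wordP => k km; apply: (wordP n y x).1 => //.
exact: leq_trans mn.
Qed.

(** If [r < f x], the open set where [f > r] contains a whole cell around [x], on which the infimum
    is at least [r]. *)
Lemma cell_inf_cvg x : cell_inf (@word R m x) @[m --> \oo] --> f x.
Proof.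
have := ereal_nondecreasing_cvgn (@cell_inf_nondecreasing x).
set S := ereal_sup _; suff -> : S = f x by [].
apply/le_anti/andP; split.
  by apply: ge_ereal_sup => _ [m _ <-]; exact: cell_inf_le.
have approx (r : R) : r%:E < f x -> r%:E <= S.
  move=> rfx; have : (\bigcup_m cell_interior m [set y | r%:E < f y]) x.
    by rewrite open_bigcup_cell_interior.
  move=> [m _ xm]; apply: (@le_trans _ _ (cell_inf (@word R m x))).
    by apply: le_ereal_inf_tmp => _ [y /= /xm/ltW ? <-].
  by apply: ereal_sup_ubound; exists m.
have S0 : 0 <= S.
  apply: le_trans (cell_inf_ge0 (word 0 x)) _.
  by apply: ereal_sup_ubound; exists 0%N.
case: S approx S0 => [s| |] approx S0; [|by rewrite leey|by []].
case: (f x) approx => [y| |] approx; last by rewrite leNye.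
  rewrite lee_fin leNgt; apply/negP => sy.
  have /approx : ((s + y) / 2)%R%:E < y%:E by rewrite lte_fin; lra.
  by rewrite lee_fin; lra.
have /approx : (s + 1)%R%:E < +oo by rewrite ltry.
by rewrite lee_fin gerDl ler10.
Qed.

Lemma measurable_cell_inf m : measurable_fun setT (fun x => cell_inf (@word R m x)).
Proof.
move=> _ B mB; rewrite setTI.
exact: (finite_rv_preimage (@finite_rv_word R m) (@cell_inf m @^-1` B)).
Qed.

Lemma measurable_lsc : measurable_fun setT f.
Proof.
apply: (emeasurable_fun_cvg (fun m x => cell_inf (@word R m x))) => [m|x _].
  exact: measurable_cell_inf.
exact: cell_inf_cvg.
Qed.

Lemma integral_cell_inf_cvg (mu : probability T R) :
  \int[mu]_x cell_inf (@word R m x) @[m --> \oo] --> \int[mu]_x f x.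
Proof.
rewrite (_ : f = fun x => limn (fun m => cell_inf (@word R m x))).
  apply: cvg_monotone_convergence => //.
  - by move=> m; exact: measurable_cell_inf.
  - by move=> m x _; exact: cell_inf_ge0.
  - by move=> x _; exact: cell_inf_nondecreasing.
by apply/funext => x; apply/esym/cvg_lim => //; exact: cell_inf_cvg.
Qed.

Lemma integral_cell_inf_le (mu : probability T R) m :
  \int[mu]_x cell_inf (@word R m x) <= \int[mu]_x f x.
Proof.
apply: ge0_le_integral => //.
- by move=> x _; exact: cell_inf_ge0.
- exact: measurable_cell_inf.
- exact: measurable_lsc.
- by move=> x _; exact: cell_inf_le.
Qed.

End lower_envelope.

(** * Nonnegativity and lower semicontinuity of [t psi_c] *)

Section potential.
Variables (R : realType) (c : torus R) (t : R).
Hypothesis t_lt0 : t < 0.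

Lemma potential_ge0 x : (0 <= t%:E * psi c x)%E.
Proof.
apply: mule_le0; first by rewrite lee_fin ltW.
rewrite /psi; apply: mule_ge0_le0 => //; rewrite lne_le0 lee_fin.
by rewrite ler_norml sin_geN1 sin_le1.
Qed.

(** Since [2 * t < 0], the condition reads [|sin (pi (b - c))| < expR (r / (2 * t))]. It also holds
    where the sine vanishes and the potential is [+oo]. *)
Lemma potential_lsc (r : R) : open [set x | (r%:E < t%:E * psi c x)%E].
Proof.
have t2_lt0 : 2 * t < 0 by rewrite pmulr_rlt0.
rewrite open_torusE -(tfracK c).
rewrite (_ : _ @^-1` _ =
    (fun b => `|sin (pi * (b - tfrac c))|) @^-1` [set y | y < expR (r / (2 * t))]).
  apply: open_comp; last exact: open_lt.
  move=> b _; apply: cvg_norm.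
  apply: (@continuous_comp _ _ _ (fun b => pi * (b - tfrac c)) sin).
    apply: cvgM; first exact: cvg_cst.
    by apply: cvgB; [exact: cvg_id|exact: cvg_cst].
  exact: continuous_sin.
apply/seteqP; split=> b; rewrite /= psi_pi; set y := `|_|.
  have : 0 <= y by exact: normr_ge0.
  rewrite le_eqVlt => /predU1P[<- _|y0]; first exact: expR_gt0.
  rewrite lne_EFin// -!EFinM lte_fin => h.
  rewrite -ltr_ln ?posrE ?expR_gt0// expRK ltr_ndivlMr//.
  by rewrite mulrC -mulrA mulrCA.
have [->|y0 h] := eqVneq y 0.
  by rewrite le0_lneNy// gt0_muleNy// lt0_muleNy// ltry.
have {}y0 : 0 < y by rewrite lt_neqAle eq_sym y0 normr_ge0.
rewrite lne_EFin// -!EFinM lte_fin.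
by move: h; rewrite -ltr_ln ?posrE ?expR_gt0// expRK ltr_ndivlMr// mulrCA mulrA mulrC.
Qed.

End potential.

(** * Comparison of the suprema *)

Section avoiding_approximation.
Variables (R : realType) (c : torus R).
Local Notation T := (torus R).
Local Notation dbl := (@doubling R).

(** The marker measure for [N = 2 ^ a] and [l = a + 2]: the marker fits into a period since
    [a >= 2], and [3 * 2 ^ a + 1 < 4 * 2 ^ a] leaves room for its choice. *)
Lemma avoiding_approximation (mu : probability T R) a : (2 <= a)%N ->
  invariant_measures mu ->
  exists2 nu, invariant_measures_avoiding c nu &
  entropy_rate dbl mu (@digit0 R) <=
    entropy_rate dbl nu (@digit0 R) + a.+2%:R / (2 ^ a)%N%:R * ln 2 /\
  forall m (F : {ffun 'I_m -> bool} -> \bar R), (forall w, 0 <= F w)%E ->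
    (((2 ^ a - m * a.+2)%N%:R / (2 ^ a)%N%:R)%:E * \int[mu]_x F (word m x) <=
     \int[nu]_x F (word m x))%E.
Proof.
move=> a2 mu_inv.
have lN : (a.+2 <= 2 ^ a)%N.
  elim: a a2 => [//|a IHa]; rewrite leq_eqVlt => /predU1P[[<-]//|/IHa].
  by rewrite expnS; lia.
have N1 : (1 < 2 ^ a)%N by apply: leq_trans lN.
have Nl : (3 * 2 ^ a + 1 < 2 ^ a.+2)%N by rewrite !expnS; lia.
have [s [[r0 r0l sr0] [U cU avoid]]] := marker_exists c lN Nl.
have N0 : (0 < 2 ^ a)%N by exact: ltnW.
exists (marker_measure mu N0 r0l lN sr0).
  split; first by move=> A mA; exact: marker_measure_invariant.
  exact: marker_measure_support cU avoid.
split; first exact: entropy_rate_marker_measure.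
by move=> m F F0; exact: integral_marker_measure.
Qed.

Lemma entropy_rate_comp_le (mu : probability T R) (I J : finType) (h : I -> J)
    (Y : T -> I) : invariant_measures mu -> finite_rv Y ->
  entropy_rate dbl mu (h \o Y) <= entropy_rate dbl mu Y.
Proof.
move=> mu_inv mY; rewrite -[leRHS]addr0.
have mf := @measurable_doubling R.
apply: (@entropy_rate_le _ _ _ _ _ mu mu _ _ _ _ 0) => //.
  exact: finite_rv_comp.
move=> n; rewrite mulr0 !addr0.
have mO : finite_rv (block n (orbit_rv dbl Y)).
  by apply: finite_rv_block => i; exact: finite_rv_orbit.
rewrite (_ : block n _ = (fun w : {ffun 'I_n -> I} =>
    [ffun i => h (w i)] : {ffun 'I_n -> J}) \o block n (orbit_rv dbl Y)).
  exact: rv_entropy_comp_le.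
by apply/funext => x; apply/ffunP => i; rewrite !ffunE.
Qed.

Lemma entropy_rate_le_ks (mu : probability T R) k (Y : T -> 'I_k) :
  finite_rv Y -> ((entropy_rate dbl mu Y)%:E <= ks_entropy dbl mu)%E.
Proof.
move=> mY; apply: ereal_sup_ubound; exists k, (fun i => Y @^-1` [set i]).
by split; [exact: finite_rv_partition|rewrite entropy_wrtE].
Qed.

Lemma entropy_rate_digit0_le_ks (mu : probability T R) :
  invariant_measures mu ->
  ((entropy_rate dbl mu (@digit0 R))%:E <= ks_entropy dbl mu)%E.
Proof.
move=> mu_inv; pose h (b : bool) : 'I_2 := inord b.
have mh : finite_rv (h \o @digit0 R).
  by apply: finite_rv_comp; exact: finite_rv_digit0.
apply: le_trans (entropy_rate_le_ks mu mh); rewrite lee_fin.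
have := entropy_rate_comp_le (fun i : 'I_2 => i == 1%N :> nat) mu_inv mh.
rewrite (_ : _ \o (h \o _) = @digit0 R)//.
by apply/funext => x /=; rewrite /h inordK; case: digit0.
Qed.

(** A starting measure to which marker insertion applies, so that the avoiding measures are not an
    empty family. *)
Lemma invariant_dirac0 : @invariant_measures R (dirac (0 : T)).
Proof.
move=> A mA; rewrite -[LHS]/(dirac (0 : T) _) -[RHS]/(dirac (0 : T) _) !diracE.
by congr ((nat_of_bool _)%:R%:E); apply/idP/idP; rewrite !inE /= /doubling mul0rn.
Qed.

End avoiding_approximation.

(** For [a >= 4] one has [a ^ 2 <= 2 ^ a] and [a + 2 <= 2 a], so the ratio is at most [2 / a]. *)
Lemma ratio_lt (R : realType) (e : R) : 0 < e ->
  exists2 a, (2 <= a)%N & a.+2%:R / (2 ^ a)%N%:R <= e.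
Proof.
move=> e0; pose a := (Num.truncn (2 / e) + 4)%N.
have a4 : (4 <= a)%N by rewrite leq_addl.
exists a; first by lia.
have sq b : (4 <= b)%N -> (b * b <= 2 ^ b)%N.
  elim: b => [//|b IHb]; rewrite leq_eqVlt => /predU1P[[<-]//|b4].
  by have := IHb b4; rewrite expnS; nia.
have a0 : 0 < a%:R :> R by rewrite ltr0n; lia.
have ea : 2 <= e * a%:R.
  rewrite mulrC -ler_pdivrMr// ltW//; apply: lt_le_trans (_ : (Num.truncn (2 / e)).+1%:R <= _).
    by rewrite truncnS_gt ?realE ?divr_ge0// ltW.
  by rewrite ler_nat /a; lia.
rewrite ler_pdivrMr ?ltr0n ?expn_gt0//.
apply: (@le_trans _ _ (e * (a * a)%N%:R)); last first.
  by rewrite ler_pM2l// ler_nat sq.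
rewrite natrM mulrA; apply: (@le_trans _ _ (2 * a%:R)); last by rewrite ler_pM2r.
by rewrite -natrM ler_nat; lia.
Qed.

(** * Passage to the limit in the approximation *)

Section suprema.
Variables (R : realType) (c : torus R) (t : R).
Hypothesis t_lt0 : t < 0.
Local Notation T := (torus R).
Local Notation dbl := (@doubling R).
Local Open Scope ereal_scope.
Let S := ereal_sup [set free_energy c t mu | mu in invariant_measures_avoiding c].
Let phi (x : T) : \bar R := t%:E * psi c x.
Let phi_ge0 : forall x, 0 <= phi x. Proof. exact: potential_ge0. Qed.
Let phi_lsc : forall r : R, open [set x | r%:E < phi x].
Proof. by move=> r; exact: potential_lsc. Qed.

Lemma sup_avoiding_ge0 : 0 <= S.
Proof.
have [nu nu_av [_ _]] := avoiding_approximation c (leqnn 2) (@invariant_dirac0 R).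
have [nu_inv _] := nu_av.
apply: (@le_trans _ _ (free_energy c t nu)); last by apply: ereal_sup_ubound; exists nu.
apply: adde_ge0; last by apply: integral_ge0 => x _; exact: phi_ge0.
apply: le_trans (entropy_rate_digit0_le_ks nu_inv); rewrite lee_fin.
apply: entropy_rate_ge0 => //; [exact: measurable_doubling|exact: finite_rv_digit0].
Qed.

(** The left side is below the free energy of the approximating measure: [e] pays for replacing [Y]
    by the first digit, the [ln 2] term for the overwritten digits. *)
Lemma approximate_free_energy_le (mu : probability T R) k (Y : T -> 'I_k) m (e : R) a :
  invariant_measures mu -> finite_rv Y -> (0 < e)%R -> (2 <= a)%N ->
  (entropy_rate dbl mu Y - e - a.+2%:R / (2 ^ a)%N%:R * ln 2)%:E +
  ((2 ^ a - m * a.+2)%N%:R / (2 ^ a)%N%:R)%:E *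
    \int[mu]_x cell_inf phi (word m x) <= S.
Proof.
move=> mu_inv mY e0 a2.
have [nu nu_av [H1 H2]] := avoiding_approximation c a2 mu_inv.
have [nu_inv _] := nu_av.
apply: (@le_trans _ _ (free_energy c t nu)); last by apply: ereal_sup_ubound; exists nu.
apply: leeD.
  apply: le_trans (entropy_rate_digit0_le_ks nu_inv); rewrite lee_fin.
  have := entropy_rate_le_digit0 mu_inv mY e0; lra.
apply: le_trans (H2 _ _ (@cell_inf_ge0 _ _ phi_ge0 m)) _.
exact: integral_cell_inf_le.
Qed.

Lemma entropy_rate_add_integral_le (mu : probability T R) k (Y : T -> 'I_k) m :
  invariant_measures mu -> finite_rv Y ->
  (entropy_rate dbl mu Y)%:E + \int[mu]_x cell_inf phi (word m x) <= S.
Proof.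
move=> mu_inv mY; have := @approximate_free_energy_le mu k Y m _ _ mu_inv mY.
have : 0 <= \int[mu]_x cell_inf phi (word m x).
  by apply: integral_ge0 => x _; exact: cell_inf_ge0.
have := sup_avoiding_ge0; move: (entropy_rate _ _ _) => h.
case: S => [S'| |//]; last by move=> *; rewrite leey.
have N0 a : (0 < (2 ^ a)%N%:R :> R)%R by rewrite ltr0n expn_gt0.
have coef a (q : R) : (a.+2%:R / (2 ^ a)%N%:R <= q)%R ->
    (1 - m%:R * q <= (2 ^ a - m * a.+2)%N%:R / (2 ^ a)%N%:R :> R)%R.
  move=> aq; rewrite ler_pdivlMr//.
  have : ((2 ^ a)%N%:R - (m * a.+2)%N%:R <= (2 ^ a - m * a.+2)%N%:R :> R)%R.
    by rewrite lerBlDr -natrD ler_nat; lia.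
  apply: le_trans; rewrite mulrBl mul1r lerD2l lerN2 natrM -mulrA.
  by rewrite ler_wpM2l// -ler_pdivrMr.
have m1 : (0 < m.+1%:R :> R)%R by [].
case: (\int[mu]_x _) => [I| |//] S0 I0 H.
  rewrite -EFinD lee_fin.
  suff approx (e : R) : (0 < e)%R -> (h + I <= S' + e)%R by exact/ler_addgt0Pr.
  move=> e0.
  rewrite lee_fin in I0.
  have ln2 : (0 <= ln 2 :> R)%R by rewrite ln_ge0// ler1n.
  (* The total loss per unit of the ratio [a.+2 / 2 ^ a], from entropy and integral; adding 1 makes
     [K] positive. A ratio at most [e / 2 / K] keeps the loss below [e / 2]. *)
  pose K : R := (ln 2 + m%:R * I + 1)%R.
  have mI : (0 <= m%:R * I)%R by rewrite mulr_ge0.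
  have K0 : (0 < K)%R by rewrite /K; lra.
  have e20 : (0 < e / 2)%R by lra.
  have [a a2 aq] := @ratio_lt R (e / 2 / K)%R (divr_gt0 e20 K0).
  have := H _ _ e20 a2; rewrite -EFinM -EFinD lee_fin.
  have := coef a _ aq; set q := (e / 2 / K)%R in aq *.
  have q0 : (0 <= q)%R by rewrite ltW// divr_gt0.
  have qK : (q * K = e / 2)%R by rewrite divfK// gt_eqF.
  move=> /(ler_wpM2r I0) h1 h2.
  have h3 := ler_wpM2r ln2 aq.
  move: h1 h2 h3 qK; rewrite /K.
  set u := ((2 ^ a - m * a.+2)%N%:R / (2 ^ a)%N%:R * I)%R.
  set v := (a.+2%:R / (2 ^ a)%N%:R * ln 2)%R.
  rewrite mulrBl mul1r !mulrDr mulr1 (mulrC m%:R) -(mulrA q).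
  lra.
(* If the integral is infinite, a ratio this small makes its coefficient positive, which contradicts
   the finiteness of the supremum. *)
have [a a2 aq] := @ratio_lt R (2 * m.+1%:R)^-1 ltac:(by rewrite invr_gt0 mulr_gt0).
have := H _ _ (ltr01 : (0 < 1 :> R)%R) a2; rewrite gt0_muley//.
rewrite lte_fin; apply: lt_le_trans (coef a _ aq).
rewrite subr_gt0 -ltr_pdivlMr ?invr_gt0 ?mulr_gt0// invrK mul1r.
by rewrite -natrM ltr_nat; lia.
Qed.

(** The supremum over partitions is taken first, at fixed [m], and then [m] tends to infinity by
    monotone convergence. *)
Lemma free_energy_le_sup_avoiding (mu : probability T R) :
  invariant_measures mu -> free_energy c t mu <= S.
Proof.
move=> mu_inv; have H k Y m mY := @entropy_rate_add_integral_le mu k Y m mu_inv mY.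
have S0 := sup_avoiding_ge0.
have I0 m : 0 <= \int[mu]_x cell_inf phi (word m x).
  by apply: integral_ge0 => x _; exact: cell_inf_ge0.
have ks0 : 0 <= ks_entropy dbl mu.
  apply: le_trans (entropy_rate_digit0_le_ks mu_inv); rewrite lee_fin.
  apply: entropy_rate_ge0 => //; [exact: measurable_doubling|exact: finite_rv_digit0].
move: S H S0 => S' H S0; case: S' S0 H => [s| |//] S0 H; last by rewrite leey.
have IS m : \int[mu]_x cell_inf phi (word m x) \is a fin_num.
  rewrite ge0_fin_numE//; apply: le_lt_trans (ltry s).
  (* The one-cell partition bounds the integral alone by [s]; its finiteness allows the subtractions
     below. *)
  pose Y (x : T) : 'I_1 := ord0.
  have mY : finite_rv Y.
    by apply: (@finite_rv_comp _ _ _ _ (fun=> ord0) _ (@finite_rv_digit0 R)).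
  apply: le_trans (H 1%N Y m mY); rewrite leeDr// lee_fin.
  by apply: entropy_rate_ge0 => //; exact: measurable_doubling.
have hS m : ks_entropy dbl mu + \int[mu]_x cell_inf phi (word m x) <= s%:E.
  rewrite -leeBrDr//; apply: ge_ereal_sup => _ [k [A [mA ->]]].
  have [Y mY ->] := measurable_partitionE mA.
  by rewrite leeBrDr// entropy_wrtE; exact: H.
have ksfin : ks_entropy dbl mu \is a fin_num.
  rewrite ge0_fin_numE//; apply: le_lt_trans (ltry s).
  by apply: le_trans (hS 0%N); rewrite leeDl.
rewrite /free_energy -leeBrDl//.
rewrite -(cvg_lim _ (integral_cell_inf_cvg phi_ge0 phi_lsc (mu := mu)))//.
apply: lime_le; first exact: cvgP (integral_cell_inf_cvg phi_ge0 phi_lsc (mu := mu)).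
by near=> m; rewrite leeBrDl.
Unshelve. all: by end_near. Qed.

End suprema.

Local Open Scope ereal_scope.

(* The strict inequality records that both suprema lie in (-oo, +oo]. *)
Theorem theorem2p7 (R : realType) (c : torus R) (t : R) (ht : (t < 0)%R) :
  -oo < ereal_sup [set free_energy c t mu | mu in invariant_measures_avoiding c]
  /\ ereal_sup [set free_energy c t mu | mu in invariant_measures_avoiding c]
     = ereal_sup [set free_energy c t mu | mu in @invariant_measures R].
Proof.
split; first by apply: lt_le_trans (sup_avoiding_ge0 c ht); rewrite ltNyr.
apply/le_anti/andP; split.
  by apply: le_ereal_sup => _ [mu [mu_inv _] <-]; exists mu.
by apply: ge_ereal_sup => _ [mu mu_inv <-]; exact: free_energy_le_sup_avoiding.
Qed.
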